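(* For every integer $t\ge 2$, there exists a $(12t+4,3,2)$-BIBD $(X,\mathcal{A})$ with a weak nesting $\phi:\mathcal{A}\to Y$, $X\subseteq Y$, where $|Y|=w=14t+6$.
   Context: A $(v,k,\lambda)$-BIBD is a pair $(X,\mathcal{A})$ where $X$ is a set of $v$ points and $\mathcal{A}$ is a multiset of $k$-subsets of $X$ (blocks) such that every pair of distinct points lies in exactly $\lambda$ blocks. A partial $(w,k,\lambda)$-BIBD is defined in the same way on $w$ points, except that every pair lies in at most $\lambda$ blocks. Given a $(v,k,\lambda)$-BIBD $(X,\mathcal{A})$ and a set $Y\supseteq X$ with $|Y|=w$, a map $\phi:\mathcal{A}\to Y$ is a weak nesting if $\phi(A)\notin A$ for every block $A$ and the multiset $\{A\cup\{\phi(A)\}:A\in\mathcal{A}\}$ is a partial $(w,k+1,\lambda+1)$-BIBD on $Y$. *)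

(* Defs.v *)
From mathcomp Require Import all_boot.
Set Implicit Arguments. Unset Strict Implicit. Unset Printing Implicit Defensive.

(* A multiset of blocks is represented as an indexed family A : 'I_b -> {set T}
   (the multiset {A i : i < b}); repeated blocks are allowed. *)

Definition is_BIBD (T : finType) (X : {set T}) (v k lam : nat) (b : nat)
    (A : 'I_b -> {set T}) : Prop :=
  [/\ #|X| = v,
      (forall i, A i \subset X /\ #|A i| = k) &
      (forall x y, x \in X -> y \in X -> x != y ->
         #|[set i | (x \in A i) && (y \in A i)]| = lam)].

Definition is_partial_BIBD (T : finType) (Y : {set T}) (w k lam : nat) (b : nat)
    (B : 'I_b -> {set T}) : Prop :=
  [/\ #|Y| = w,
      (forall i, B i \subset Y /\ #|B i| = k) &
      (forall x y, x \in Y -> y \in Y -> x != y ->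
         #|[set i | (x \in B i) && (y \in B i)]| <= lam)].

Definition weak_nesting (T : finType) (X Y : {set T}) (v k lam w : nat) (b : nat)
    (A : 'I_b -> {set T}) (phi : 'I_b -> T) : Prop :=
  [/\ is_BIBD X v k lam A,
      X \subset Y,
      (forall i, phi i \in Y),
      (forall i, phi i \notin A i) &
      is_partial_BIBD Y w k.+1 lam.+1 (fun i => A i :|: [set phi i])].

(* Main.v *)
Require Import Defs.
From HB Require Import structures.
From mathcomp Require Import all_boot all_algebra zify.

(* Put k = 4t + 1, so that 12t + 4 = 3k + 1, and take as points a point oo and three copies
   (levels) of an abelian group R = R0 x E of odd order k.  Let rho be an automorphism of R0
   such that rho + 1 and rho - 1 are automorphisms too, and let H contain exactly one of
   d, -d for each nonzero d in R0.  If E is trivial, most of the blocks are the translates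
   A_d = {d_0, (-d)_1, (rho d)_2} + m and B_d = {(rho d)_0, (- rho d)_1, d_2} + m; the block
   A_d + m is nested at m_0 if d is in H and at m_1 if -d is in H, and B_d + m is nested at
   m_2 if d is in H.  The differences between nesting points and block points on levels i, j
   then fill a half-system, and the two half-systems met by a pair of levels are opposite, so
   that no pair is used twice.  For fixed d the blocks form a parallel class, and the parallel
   classes that are not nested go three by three to the outer points.  The triples inside one
   level all go to outer points; they come from a twofold Skolem-type family of difference
   triples if k is prime to 3, and from two copies of the Bose triple system otherwise.  The
   blocks through oo either replace one parallel class or fill a difference left over inside
   the levels.

   Modulo 3 no automorphism rho of a cyclic group can work.  This is repaired by giving the
   3-part of R0 the form (Z/m)^2, where rho is the multiplication by i on Gaussian integers,
   and a possible remaining factor 3 is absorbed by E, on which H does not depend. *)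

Set Implicit Arguments. Unset Strict Implicit. Unset Printing Implicit Defensive.
Import GRing.Theory.

(** * From oriented triples to a weak nesting *)

Definition o0 : 'I_3 := @Ordinal 3 0 isT.
Definition o1 : 'I_3 := @Ordinal 3 1 isT.
Definition o2 : 'I_3 := @Ordinal 3 2 isT.

Lemma ord3_ind (Q : 'I_3 -> Prop) : Q o0 -> Q o1 -> Q o2 -> forall i, Q i.
Proof.
move=> Q0 Q1 Q2 [[|[|[|//]]] lti].
- by rewrite (_ : Ordinal lti = o0) //; apply: val_inj.
- by rewrite (_ : Ordinal lti = o1) //; apply: val_inj.
- by rewrite (_ : Ordinal lti = o2) //; apply: val_inj.
Qed.

Definition sel3 (T : Type) (a b c : T) (i : 'I_3) : T :=
  match val i with 0 => a | 1 => b | _ => c end.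

Definition nx (i : 'I_3) : 'I_3 := sel3 o1 o2 o0 i.

(* Edge [e] of a triple is the one opposite to vertex [e]. *)
Definition dedge (P : Type) (v : 'I_3 -> P) (o : 'I_3 -> bool) (e : 'I_3) : P * P :=
  let x := v (sel3 o1 o2 o0 e) in let y := v (sel3 o2 o0 o1 e) in
  if o e then (x, y) else (y, x).

Lemma dedge_cover (P : Type) (v : 'I_3 -> P) (o : 'I_3 -> bool) (a b : 'I_3) :
  a != b -> exists e, dedge v o e = (v a, v b) \/ dedge v o e = (v b, v a).
Proof.
rewrite /dedge; elim/ord3_ind: a; elim/ord3_ind: b => // _;
  by [exists o0; case: (o o0); auto | exists o1; case: (o o1); auto
     | exists o2; case: (o o2); auto].
Qed.

Section Assembly.
Variables (P J : finType) (N : nat) (V : {set J}).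
Variables (vert : J -> 'I_3 -> P) (ori : J -> 'I_3 -> bool).
Variables (phi : J -> P + 'I_N) (slot : J -> 'I_3 -> 'I_3).

Hypothesis size_V : 3 * #|V| = #|P| * #|P|.-1.
Hypothesis vert_inj : forall j, j \in V -> injective (vert j).
Hypothesis dedge_inj : forall i j e f, i \in V -> j \in V ->
  dedge (vert i) (ori i) e = dedge (vert j) (ori j) f -> i = j.
Hypothesis phi_out : forall j e, j \in V -> phi j <> inl (vert j e).
Hypothesis nest_inj : forall i j e f p, i \in V -> j \in V ->
  phi i = inl p -> phi j = inl p -> vert i e = vert j f -> i = j.
Hypothesis nest_asym : forall i j e f, i \in V -> j \in V ->
  phi i = inl (vert j f) -> phi j = inl (vert i e) -> False.
Hypothesis host_inj : forall i j e f h, i \in V -> j \in V ->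
  phi i = inr h -> phi j = inr h -> slot i e = slot j f -> vert i e = vert j f -> i = j.

Let pairs := [set p : P * P | p.1 != p.2].
Let has2 (j : J) (p : P * P) :=
  [exists e, vert j e == p.1] && [exists e, vert j e == p.2].
Let cov (p : P * P) := #|[set j in V | has2 j p]|.

Let card_pairs : #|pairs| = #|P| * #|P|.-1.
Proof.
rewrite -[LHS](@card_imset _ _ id) // imset_id.
rewrite -sum1_card (eq_bigl (fun p => true && (p.1 != p.2))); last by move=> p; rewrite inE.
rewrite -(pair_big_dep xpredT (fun x y => x != y) (fun _ _ => 1)) /=.
under eq_bigr => x _.
  rewrite sum1_card (_ : #|_| = #|P|.-1); first over.
  rewrite -(cardC1 x) /=; by apply: eq_card => y; rewrite !inE eq_sym.
by rewrite sum_nat_const.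
Qed.

Let covE j p : j \in V -> p \in pairs -> has2 j p ->
  exists e, dedge (vert j) (ori j) e = p \/ dedge (vert j) (ori j) e = (p.2, p.1).
Proof.
case: p => u v jV; rewrite inE /= => uv /andP[/existsP[a /eqP va] /existsP[b /eqP vb]].
have ab : a != b by apply: contraNneq uv => ab; rewrite -[u]va -[v]vb ab.
have [e he] := dedge_cover (vert j) (ori j) ab.
by exists e; move: he; rewrite va vb.
Qed.

(** By [dedge_inj], distinct blocks through a pair orient it in opposite ways, so the boolean [f]
    that records the orientation is injective on them. *)
Let cov_le2 p : p \in pairs -> cov p <= 2.
Proof.
move=> pp; pose f j := [exists e, dedge (vert j) (ori j) e == p].
suff f_inj : {in [set j in V | has2 j p] &, injective f}.
  by rewrite /cov -(card_in_imset f_inj) -[X in _ <= X]card_bool max_card.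
move=> i j; rewrite !inE => /andP[iV hi] /andP[jV hj].
rewrite /f; have [ei Ei] := covE iV pp hi; have [ej Ej] := covE jV pp hj.
case: existsP => [[e /eqP he]|nei]; case: existsP => [[e' /eqP he']|nej] //.
  by move=> _; apply: (@dedge_inj i j e e') => //; rewrite he he'.
move=> _; apply: (@dedge_inj i j ei ej) => //.
case: Ei => Ei; first by case: nei; exists ei; apply/eqP.
case: Ej => Ej; first by case: nej; exists ej; apply/eqP.
by rewrite Ei Ej.
Qed.

Let has2_card j : j \in V -> #|[set p in pairs | has2 j p]| = 6.
Proof.
move=> jV; pose S := [set vert j e | e : 'I_3].
have S3 : #|S| = 3 by rewrite card_imset ?card_ord //; apply: vert_inj.
have Sin u : [exists e, vert j e == u] = (u \in S).
  by apply/existsP/imsetP => [[e /eqP <-]|[e _ ->]]; exists e.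
have -> : [set p in pairs | has2 j p] = setX S S :\: [set (x, x) | x in S].
  apply/setP=> -[u v]; rewrite !inE /has2 /= !Sin.
  case: (boolP (_ \in [set (x,x) | x in S])) => /= [/imsetP[x xS [-> ->]]|h].
    by rewrite eqxx.
  case uS: (u \in S) => /=; last by rewrite andbF.
  case vS: (v \in S) => /=; rewrite ?andbF ?andbT //.
  by apply: contraNneq h => <-; apply/imsetP; exists u.
rewrite cardsD cardsX S3 (setIidPr _).
  by rewrite (card_imset _ (f := fun x => (x, x))) ?S3 // => x y [].
by apply/subsetP=> ? /imsetP[x xS ->]; rewrite inE /= xS.
Qed.

(* Every pair is covered at most twice, and the number of blocks leaves no slack. *)
Let cov_eq2 p : p \in pairs -> cov p = 2.
Proof.
have le2 q : q \in pairs -> cov q <= 2 ?= iff (cov q == 2).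
  by move=> qp; apply/leqifP; case: (boolP (cov q == 2)) => [//|h]; rewrite ltn_neqAle h cov_le2.
have [_] := leqif_sum le2.
have -> : \sum_(q in pairs) cov q = \sum_(j in V) 6.
  have covS q : cov q = \sum_(j in V | has2 j q) 1.
    by rewrite /cov -sum1_card; apply: eq_bigl => j; rewrite inE.
  under eq_bigr => q _ do rewrite covS.
  rewrite (exchange_big_dep (fun j => j \in V)) /=; last by move=> q j _ /andP[].
  apply: eq_bigr => j jV; rewrite -(has2_card jV) -sum1_card.
  by apply: eq_bigl => q; rewrite inE jV.
rewrite !sum_nat_const card_pairs -size_V.
rewrite (_ : (_ == _) = true); last by apply/eqP; lia.
by move=> /esym /forall_inP h pp; apply/eqP/h.
Qed.

Let Y : finType := (P + 'I_N)%type.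
Let blk (j : J) : {set Y} := [set inl (vert j e) | e : 'I_3].

Let blkl j u : (inl u \in blk j) = [exists e, vert j e == u].
Proof.
by apply/imsetP/existsP => [[e _ [->]]|[e /eqP <-]]; exists e.
Qed.

Let blkr j h : (inr h \in blk j) = false.
Proof. by apply/imsetP => -[]. Qed.

(** The slots colour the blocks through [u] hosted by [h] injectively with three colours. The
    default [o0] in [f] is never reached: each such block has a vertex [u]. *)
Let host_le3 u h :
  #|[set j in V | (inl u \in blk j) && (phi j == inr h)]| <= 3.
Proof.
pose f j := if [pick e | vert j e == u] is Some e then slot j e else o0.
suff f_inj : {in [set j in V | (inl u \in blk j) && (phi j == inr h)] &, injective f}.
  by rewrite -(card_in_imset f_inj) -[X in _ <= X](card_ord 3) max_card.
move=> i j; rewrite !inE !blkl => /and3P[iV /existsP[ei Ei] /eqP hi].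
move=> /and3P[jV /existsP[ej Ej] /eqP hj]; rewrite /f.
case: pickP => [e /eqP Ee|/(_ ei)]; last by rewrite Ei.
case: pickP => [e' /eqP Ee'|/(_ ej)]; last by rewrite Ej.
by move=> es; apply: (host_inj iV jV hi hj es); rewrite Ee Ee'.
Qed.

(** [nest_inj] excludes two blocks nested at the same end of the pair, [nest_asym] one block nested
    at each end. *)
Let nest_le1 u v :
  #|[set j in V | (inl u \in blk j) && (phi j == inl v)]
    :|: [set j in V | (inl v \in blk j) && (phi j == inl u)]| <= 1.
Proof.
apply/card_le1_eqP => i j; rewrite !inE !blkl => iU jU; move: iU jU.
case/orP=> /and3P[iV /existsP[ei /eqP Ei] /eqP hi];
case/orP=> /and3P[jV /existsP[ej /eqP Ej] /eqP hj].
- by apply/esym/(nest_inj (e := ei) (f := ej) iV jV hi hj); rewrite Ei Ej.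
- by exfalso; apply: (@nest_asym i j ei ej) => //; rewrite ?Ei ?Ej.
- by exfalso; apply: (@nest_asym i j ei ej) => //; rewrite ?Ei ?Ej.
- by apply/esym/(nest_inj (e := ei) (f := ej) iV jV hi hj); rewrite Ei Ej.
Qed.

(** Two design points share two blocks and at most one nesting pair; a design point and an outer
    point share at most three hosted blocks; two outer points share none. *)
Let cov_small p q : p != q ->
  #|[set j in V | (p \in blk j :|: [set phi j]) && (q \in blk j :|: [set phi j])]| <= 3.
Proof.
case: p q => [u|h] [v|h'] pq.
- have pp : (u, v) \in pairs by rewrite inE.
  apply: leq_trans (leq_add (eq_leq (cov_eq2 pp)) (nest_le1 u v)).
  apply: leq_trans (leq_card_setU _ _); apply: subset_leq_card; apply/subsetP=> j.
  rewrite !inE !blkl /has2 /=; case/and3P => ->.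
  case/orP => [->|/eqP E]; case/orP => [->|/eqP E'] //=.
  + by rewrite E' eqxx orbT.
  + by rewrite E eqxx !orbT.
  + by move: E' pq; rewrite -E => ->; rewrite eqxx.
- apply: leq_trans (host_le3 u h'); apply: subset_leq_card; apply/subsetP=> j.
  rewrite !inE !blkr /=; case/and3P=> -> Hu /eqP E.
  by move: Hu; rewrite -E orbF eqxx andbT.
- apply: leq_trans (host_le3 v h); apply: subset_leq_card; apply/subsetP=> j.
  rewrite !inE !blkr /=; case/and3P=> -> /eqP E Hu.
  by move: Hu; rewrite -E orbF eqxx andbT.
- rewrite (_ : [set j in V | _] = set0) ?cards0 //.
  apply/setP => j; rewrite !inE !blkr /=; apply/and3P => -[_ /eqP E /eqP E'].
  by move: pq; rewrite E E' eqxx.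
Qed.

Lemma weak_nesting_assembly (w : nat) : w = #|P| + N ->
  exists (X : {set 'I_w}) (b : nat) (A : 'I_b -> {set 'I_w}) (phi : 'I_b -> 'I_w),
    weak_nesting X [set: 'I_w] #|P| 3 2 w A phi.
Proof.
move=> wE; have cY : #|Y| = w by rewrite card_sum card_ord.
pose g (y : Y) : 'I_w := cast_ord cY (enum_rank y).
pose gi (x : 'I_w) : Y := enum_val (cast_ord (esym cY) x).
have gK : cancel g gi by move=> y; rewrite /g /gi cast_ordK enum_rankK.
have giK : cancel gi g by move=> x; rewrite /g /gi enum_valK cast_ordKV.
have g_inj : injective g := can_inj gK.
have mem_g y (S : {set Y}) : (g y \in g @: S) = (y \in S) by rewrite mem_imset.
pose X0 : {set Y} := [set inl x | x : P].
pose bj (i : 'I_#|V|) := enum_val i.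
have bjV i : bj i \in V by apply: enum_valP.
exists (g @: X0), #|V|, (fun i => g @: blk (bj i)), (fun i => g (phi (bj i))).
have count (Q : pred J) : #|[set i | Q (bj i)]| = #|[set j in V | Q j]|.
  rewrite -(card_imset _ (enum_val_inj (A:=V))); apply: eq_card => j.
  apply/imsetP/idP => [[i]|]; first by rewrite !inE => Qi ->; rewrite bjV.
  rewrite inE => /andP[jV Qj]; exists (enum_rank_in jV j).
    by rewrite inE /bj enum_rankK_in.
  by rewrite enum_rankK_in.
have blk3 i : #|g @: blk (bj i)| = 3.
  rewrite card_imset // /blk card_imset ?card_ord // => a b [].
  exact: vert_inj.
split.
- split.
  + by rewrite card_imset // card_imset // => a b [].
  + move=> i; split=> //; apply: imsetS; apply/subsetP => y /imsetP[e _ ->].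
    by apply/imsetP; exists (vert (bj i) e).
  + move=> ? ? /imsetP[y /imsetP[u _ ->] ->] /imsetP[z /imsetP[v _ ->] ->] uv.
    rewrite (count (fun j => (g (inl u) \in g @: blk j) && (g (inl v) \in g @: blk j))).
    have uv' : u != v by apply: contraNneq uv => ->.
    have pp : (u, v) \in pairs by rewrite inE.
    rewrite -(cov_eq2 pp); apply: eq_card => j; by rewrite !inE !mem_g !blkl.
- exact: subsetT.
- by move=> i; rewrite inE.
- move=> i; rewrite mem_g; apply/imsetP => -[e _]; exact: phi_out.
- split.
  + by rewrite cardsT card_ord.
  + move=> i; split; first exact: subsetT.
    rewrite setUC cardsU1 mem_g blk3 (_ : _ \notin _) //.
    by apply/imsetP => -[e _]; exact: phi_out.
  + move=> x y _ _; rewrite -[x]giK -[y]giK => xy.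
    have {}xy : gi x != gi y by apply: contraNneq xy => ->.
    rewrite (count (fun j => (g (gi x) \in g @: blk j :|: [set g (phi j)])
                     && (g (gi y) \in g @: blk j :|: [set g (phi j)]))).
    apply: leq_trans (cov_small xy); apply: subset_leq_card; apply/subsetP => j.
    by rewrite !inE !mem_g !(inj_eq g_inj).
Qed.
End Assembly.

Local Open Scope ring_scope.

(** * The nested blocks and the blocks through the extra point *)

(** Joins the finite and the additive structure of a product into a [finZmodType]. *)
HB.instance Definition _ (A B : finZmodType) := GRing.Zmodule.on (A * B)%type.

Section Cells.
Variables (R0 E : finZmodType) (rho : R0 -> R0).
Hypothesis rhoB : {morph rho : x y / x - y}.
Hypothesis double0 : forall x : R0, x + x = 0 -> x = 0.
Hypothesis doubleE : forall x : E, x + x = 0 -> x = 0.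
Hypothesis rho_eq0 : forall x, rho x = 0 -> x = 0.
Hypothesis rho_fix : forall x, rho x = x -> x = 0.
Hypothesis rho_opp : forall x, rho x = - x -> x = 0.

Local Notation R := (R0 * E)%type.

Lemma rho0 : rho 0 = 0. Proof. by have := rhoB 0 0; rewrite !subrr. Qed.
Lemma rhoN x : rho (- x) = - rho x. Proof. by rewrite -sub0r rhoB rho0 sub0r. Qed.

(* A cell [c = ((m, mu), (d, nu))] is the base block [d], of type A if [b] and B otherwise,
   translated by [m]; over [E], the coordinates mu + nu, nu, mu - nu of its vertices and the
   coordinate mu of its nesting point form an orthogonal array. *)
Definition slope (b : bool) (l : 'I_3) (d : R0) : R0 :=
  if b then sel3 d (- d) (rho d) l else sel3 (rho d) (- rho d) d l.

Definition vtx (b : bool) (l : 'I_3) (c : R * R) : R :=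
  (c.1.1 + slope b l c.2.1, sel3 (c.1.2 + c.2.2) c.2.2 (c.1.2 - c.2.2) l).

Lemma slopeB b l : {morph slope b l : x y / x - y}.
Proof.
by case: b; elim/ord3_ind: l => x y; rewrite /slope /sel3 /= ?rhoB ?opprB ?opprK // addrC.
Qed.

Lemma slope_eq0 b l d : slope b l d = 0 -> d = 0.
Proof.
have opp0 x : - x = 0 -> x = 0 :> R0 by move/eqP; rewrite oppr_eq0 => /eqP.
by case: b; elim/ord3_ind: l; rewrite /slope /sel3 //=; [exact: opp0|exact: rho_eq0
  |exact: rho_eq0|by move/opp0/rho_eq0].
Qed.

(** Up to sign, the difference of two slopes is 2d, 2 rho d, (rho - 1) d or (rho + 1) d, and all
    these maps are injective. *)
Lemma slope_neq b l l' d : l != l' -> slope b l d = slope b l' d -> d = 0.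
Proof.
have opp0 x : x = - x -> x = 0 :> R0 by move=> h; apply: double0; rewrite {1}h addNr.
by case: b; elim/ord3_ind: l; elim/ord3_ind: l'; rewrite /slope /sel3 //= => _;
  first [by move/esym/opp0|by move/opp0|by move/rho_opp|by move/esym/rho_opp
     |by move/rho_fix|by move/esym/rho_fix
     |by move/opp0/rho_eq0|by move/esym/opp0/rho_eq0
     |by move=> h; apply: rho_opp; apply: oppr_inj; rewrite opprK].
Qed.

(** Hence each type covers a pair of points on two levels at most once. Over [R0] the difference of
    the slopes gives d; over [E] any two of mu + nu, nu, mu - nu determine mu and nu, as doubling is
    injective. *)
Lemma vtx_pair b l l' c c' : l != l' ->
  vtx b l c = vtx b l c' -> vtx b l' c = vtx b l' c' -> c = c'.
Proof.
case: c c' => [[m mu] [d nu]] [[m' mu'] [d' nu']] ll' [] /= h1 k1 [] h2 k2.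
have {}hd : d = d'.
  apply/eqP; rewrite -subr_eq0; apply/eqP/(slope_neq (b := b) ll').
  rewrite !slopeB; apply: (addrI (m - m')).
  have aux x y x' y' : x + y = x' + y' -> (x - x') + (y - y') = 0 :> R0.
    by move=> h; rewrite addrACA h -opprD subrr.
  by rewrite (aux _ _ _ _ h1) (aux _ _ _ _ h2).
have hm : m = m' by move: h1; rewrite hd => /addIr.
have hE : mu = mu' /\ nu = nu'.
  have dbl x y : x + x = y + y -> x = y :> E.
    move=> h; apply/eqP; rewrite -subr_eq0; apply/eqP/doubleE.
    by rewrite addrACA h -opprD subrr.
  have dbl_sum x y : x + x = (x + y) + (x - y) :> E by rewrite addrACA subrr addr0.
  move: ll' k1 k2; clear - dbl dbl_sum.
  elim/ord3_ind: l; elim/ord3_ind: l'; rewrite /sel3 //= => _.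
  - by move=> h k; move: h; rewrite k => /addIr.
  - move=> h k; have hm : mu = mu' by apply: dbl; rewrite (dbl_sum mu nu) h k -dbl_sum.
    by move: h; rewrite hm => /addrI.
  - by move=> k h; move: h; rewrite k => /addIr.
  - by move=> k h; move: h; rewrite k => /addIr.
  - move=> k h; have hm : mu = mu' by apply: dbl; rewrite (dbl_sum mu nu) h k -dbl_sum.
    by move: h; rewrite hm => /addrI.
  - by move=> h k; move: h; rewrite k => /addIr.
by rewrite hd hm hE.1 hE.2.
Qed.

Lemma vtx_center b l c c' : c.1 = c'.1 -> vtx b l c = vtx b l c' -> c = c'.
Proof.
case: c c' => [[m mu] [d nu]] [[m' mu'] [d' nu']] /= [<- <-] [] /= /addrI h1 h2.
congr (_, (_, _)); last first.
  by move: h2; elim/ord3_ind: l h1; rewrite /sel3 //= => _ /addrI // /oppr_inj.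
apply/eqP; rewrite -subr_eq0; apply/eqP/(slope_eq0 (b := b) (l := l)).
by rewrite slopeB h1 subrr.
Qed.

(** The cells of one type with fixed d and mu form a parallel class, so a single slot of an outer
    point can take all of them. *)
Lemma vtx_class b l c c' : c.2.1 = c'.2.1 -> c.1.2 = c'.1.2 ->
  vtx b l c = vtx b l c' -> c = c'.
Proof.
case: c c' => [[m mu] [d nu]] [[m' mu'] [d' nu']] /= <- <- [] /= /addIr <- h2.
congr (_, (_, _)).
by move: h2; elim/ord3_ind: l; rewrite /sel3 //= => /addrI // /oppr_inj.
Qed.

(** The half-system H: the enumeration of [R0] chooses between d and - d. *)
Definition pos (d : R0) : bool := (enum_rank d < enum_rank (- d)%R)%N.

Lemma pos_opp d : pos d -> pos (- d) -> False.
Proof. by rewrite /pos opprK => h1 h2; move: (ltn_trans h1 h2); rewrite ltnn. Qed.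

Lemma pos_neq0 d : pos d -> d <> 0.
Proof. by move=> pd d0; move: pd; rewrite /pos d0 oppr0 ltnn. Qed.

Lemma posVopp d : d != 0 -> ~~ pos d -> pos (- d).
Proof.
move=> d0; rewrite /pos opprK -leqNgt leq_eqVlt => /orP[|//].
rewrite (inj_eq val_inj) (inj_eq enum_rank_inj) => /eqP h.
by move: d0; rewrite (double0 (x := d)) ?eqxx // -{1}h addNr.
Qed.

(* [r] is the translation used by the blocks through the extra point; the blocks whose
   nesting would collide with those are left to the outer points.  If [full] holds, the
   blocks through the extra point are {oo, x, x + r} inside each level; otherwise they come
   from the triples {x, y, z} of the class [pi], each replaced by the three blocks {oo, x, y},
   {oo, y, z}, {oo, x, z}. *)
Variables (r : R) (full : bool).

Definition nestA (d : R0) : bool :=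
  [&& d != 0, d != r.1, d != - r.1 & rho d != - r.1].
Definition nestB (d : R0) : bool := [&& pos d, rho d != r.1 & rho d != - r.1].

(** The class with d = 0 and mu = 0. The vertices of [pi x] are x on levels 0 and 1, and
    [(x.1, - x.2)] on level 2. *)
Definition pi (x : R) : R * R := ((x.1, 0), (0, x.2)).

Definition kept (cb : (R * R) * bool) : bool :=
  [|| ~~ cb.2, full, cb.1.2.1 != 0 | cb.1.1.2 != 0].

Lemma pi_kept x : kept (pi x, true) = full.
Proof. by rewrite /kept /= !eqxx !orbF. Qed.

Lemma vtx_pi_inj l x y : vtx true l (pi x) = vtx true l (pi y) -> x = y.
Proof. by move/vtx_class => /(_ erefl erefl); case: x y => [? ?] [? ?] [-> ->]. Qed.

(** Elements are whole parallel classes, given by type, d and mu, that remain for the outer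
    points. *)
Definition pool : {set bool * (R0 * E)} :=
  [set u | ~~ (if u.1 then nestA u.2.1 else nestB u.2.1)
     & [|| ~~ u.1, full, u.2.1 != 0 | u.2.2 != 0]].

Lemma card_rho_fiber x : (#|[set d | rho d == x]| <= 1)%N.
Proof.
apply/card_le1_eqP => d d'; rewrite !inE => /eqP h /eqP h'.
apply/eqP; rewrite -subr_eq0; apply/eqP/rho_eq0; by rewrite rhoB h h' subrr.
Qed.

Lemma card_unnestedA : (#|[set d | ~~ nestA d]| <= 1 + 3 * (r.1 != 0%R))%N.
Proof.
case: eqP => [r0|_].
  rewrite muln0 addn0 -(cards1 (0 : R0)); apply: subset_leq_card; apply/subsetP => d.
  rewrite !inE /nestA r0 oppr0; apply: contraNT => d0; rewrite d0 /=.
  by apply: contra_neq d0; apply: rho_eq0.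
apply: (@leq_trans #|[set 0; r.1; - r.1] :|: [set d | rho d == - r.1]|).
  apply: subset_leq_card; apply/subsetP => d.
  by rewrite !inE /nestA !negb_and !negbK -!orbA.
rewrite (_ : (1 + 3 * ~~ false = 2 + 1 + 1)%N) //.
apply: leq_trans (leq_card_setU _ _) (leq_add _ (card_rho_fiber _)).
apply: leq_trans (leq_card_setU _ _) (leq_add _ _); last by rewrite cards1.
by rewrite cards2; case: (_ != _).
Qed.

(** [nB], its opposites, 0 and the solutions of rho d = r.1 or rho d = - r.1 cover [R0]; there are
    at most two such solutions, and they are left out if r.1 = 0. *)
Lemma card_unnestedB : (2 * #|[set d | ~~ nestB d]| <= #|R0| + 1 + 2 * (r.1 != 0%R))%N.
Proof.
pose nB := [set d | nestB d].
have cC : (#|nB| + #|[set d | ~~ nestB d]| = #|R0|)%N.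
  by rewrite -(cardsC nB); congr addn; apply: eq_card => d; rewrite !inE.
suff : (#|R0| <= 2 * #|nB| + 1 + 2 * (r.1 != 0%R))%N by move: cC; lia.
pose bad := if r.1 == 0 then set0 else [set d | rho d == r.1] :|: [set d | rho d == - r.1].
have badle : (#|bad| <= 2 * (r.1 != 0%R))%N.
  rewrite /bad; case: eqP => _; first by rewrite cards0.
  exact: leq_trans (leq_card_setU _ _) (leq_add (card_rho_fiber _) (card_rho_fiber _)).
have cover : setT \subset (nB :|: [set - d | d in nB]) :|: [set 0] :|: bad.
  apply/subsetP => d _; rewrite !inE.
  case: (boolP (d == 0)) => [|d0]; first by rewrite orbT.
  rewrite orbF orbC; case: (boolP (d \in bad)) => //= nbad.
  have hd x : x = d \/ x = - d -> (rho x != r.1) && (rho x != - r.1).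
    have rd0 : rho d != 0 by apply: contra_neq d0; apply: rho_eq0.
    move: nbad; rewrite /bad; case: eqP => [->|_].
      by move=> _ [] ->; rewrite ?rhoN oppr0 ?oppr_eq0 rd0.
    rewrite !inE negb_or => /andP[h1 h2] [] -> ; rewrite ?h1 ?h2 // rhoN.
    by rewrite (inj_eq oppr_inj) h1 andbT; apply: contra_neq h2 => <-; rewrite opprK.
  case: (boolP (pos d)) => pd; first by rewrite /nestB pd hd //; left.
  rewrite orbC; apply/orP; left; apply/imsetP; exists (- d); last by rewrite opprK.
  by rewrite inE /nestB posVopp // hd //; right.
have := subset_leq_card cover; rewrite cardsT => h.
apply: leq_trans h _; apply: leq_trans (leq_card_setU _ _) (leq_add _ badle).
apply: leq_trans (leq_card_setU _ _) _; rewrite cards1 leq_add2r.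
by apply: leq_trans (leq_card_setU _ _) _; rewrite (card_imset _ oppr_inj) mul2n addnn.
Qed.

Lemma card_pool :
  (2 * #|pool| + 2 * ~~ full <= #|E| * (#|R0| + 3 + 8 * (r.1 != 0%R)))%N.
Proof.
pose DA := [set d | ~~ nestA d]; pose DB := [set d | ~~ nestB d].
(* The class replaced by blocks through oo is not nested, but needs no outer point either; this
   saves one class unless [full]. *)
pose extra : {set bool * (R0 * E)} := if full then set0 else [set (true, (0, 0))].
have exE : #|extra| = ~~ full by rewrite /extra; case: full; rewrite ?cards0 ?cards1.
have dis : pool :&: extra = set0.
  apply/setP => -[b [d mu]]; rewrite /extra !inE; case: (boolP full) => fl.
    by rewrite inE andbF.
  rewrite inE; apply/negP => /andP[/andP[_ h] /eqP[bE dE mE]].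
  by move: h; rewrite bE dE mE /= !eqxx.
pose f (b : bool) (u : R0 * E) := (b, u).
have f_inj b : injective (f b) by move=> u v [].
have sub : pool :|: extra \subset (f true @: setX DA setT) :|: (f false @: setX DB setT).
  apply/subsetP => -[b [d mu]] h; have hd : ~~ (if b then nestA d else nestB d).
    move: h; rewrite in_setU => /orP[|]; first by rewrite inE => /andP[].
    rewrite /extra; case: full; rewrite inE // => /eqP[-> -> _].
    by rewrite /nestA eqxx.
  by rewrite in_setU; case: b hd {h} => hd; apply/orP; [left|right];
    apply/imsetP; exists (d, mu) => //; rewrite !inE hd.
have := subset_leq_card sub; rewrite cardsU dis cards0 subn0 exE => h.
have {}h : (#|pool| + ~~ full <= (#|DA| + #|DB|) * #|E|)%N.
  apply: leq_trans h _; apply: leq_trans (leq_card_setU _ _) _.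
  by rewrite !card_imset // !cardsX !cardsT mulnDl.
have := card_unnestedA; have := card_unnestedB; rewrite -/DA -/DB => hB hA.
move: (#|DA|) (#|DB|) (#|pool|) (#|E|) (#|R0|) hA hB h => a b p e s hA hB h.
have : (2 * (a + b) <= s + 3 + 8 * (r.1 != 0%R))%N by lia.
move=> /(leq_mul (leqnn e)); lia.
Qed.

(** * The whole block system, its orientation and its nesting *)

Hypothesis r_neq0 : r != 0.

Local Notation P := (option (R * 'I_3)).

Variables (JT : finType) (vT : JT -> 'I_3 -> R) (oT : JT -> 'I_3 -> bool).
Variables (MT : nat) (hT : JT -> 'I_MT) (sT : JT -> 'I_3 -> 'I_3).
Hypothesis size_T : (3 * #|JT| = #|{: R}| * (#|{: R}| - 1 - full))%N.
Hypothesis vT_inj : forall j, injective (vT j).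
Hypothesis dedgeT_inj : forall i j e f, dedge (vT i) (oT i) e = dedge (vT j) (oT j) f -> i = j.
Hypothesis hostT_inj : forall i j e f, hT i = hT j -> sT i e = sT j f ->
  vT i e = vT j f -> i = j.
Hypothesis dedgeT_gap : full ->
  forall j e, (dedge (vT j) (oT j) e).2 <> (dedge (vT j) (oT j) e).1 + r.

Local Notation JC := ((R * R) * bool)%type.
Local Notation JI := (R * 'I_3)%type.
Local Notation J := ((JC + (JI + JT * 'I_3))%type).

Lemma point_inj (x y : R) (a b : 'I_3) : Some (x, a) = Some (y, b) :> P -> a = b /\ x = y.
Proof. by case=> -> ->. Qed.

Definition vertI (i : JI) : 'I_3 -> P :=
  let: (x, l) := i in
  if full then sel3 None (Some (x, l)) (Some (x + r, l))
  else sel3 None (Some (vtx true l (pi x), l)) (Some (vtx true (nx l) (pi x), nx l)).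

(** Edge [o0] is the one that avoids oo. Unless [full], it is reversed for the block on levels 2 and
    0, so that it points upwards like the edge of type A that it replaces. *)
Definition oriI (i : JI) (e : 'I_3) : bool := full || (e != o0) || (i.2 != o2).

(** If [full], blocks of level l are nested on the cyclically next level. Otherwise each block is
    nested on the level that it misses; without the shift by r, the second and third block of a
    triple would both use the pair of its vertices on levels 0 and 1. *)
Definition phiI (i : JI) : R * 'I_3 :=
  let: (x, l) := i in
  if full then sel3 (x, o1) (x, o2) (x + r, o0) l
  else sel3 (vtx true o2 (pi x), o2) (x + r, o0) (x + r, o1) l.

Definition vert (j : J) : 'I_3 -> P :=
  match j with
  | inl (c, b) => fun l => Some (vtx b l c, l)
  | inr (inl i) => vertI i
  | inr (inr (j, l)) => fun e => Some (vT j e, l)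
  end.

Definition ori (j : J) : 'I_3 -> bool :=
  match j with
  | inl (_, b) => fun e => (e == o1) != b
  | inr (inl i) => oriI i
  | inr (inr (j, _)) => oT j
  end.

Definition nested (cb : JC) : bool := if cb.2 then nestA cb.1.2.1 else nestB cb.1.2.1.
Definition level (cb : JC) : 'I_3 :=
  if cb.2 then (if pos cb.1.2.1 then o0 else o1) else o2.

Definition class (cb : JC) : bool * (R0 * E) := (cb.2, (cb.1.2.1, cb.1.1.2)).

Variable N : nat.
Hypothesis pool_small : (#|pool| <= 3 * (N.+1 - MT))%N.
Hypothesis MT_small : (MT <= N.+1)%N.

Definition rank (cb : JC) : nat := index (class cb) (enum pool).

(** The outer points below [MT] host the triples inside the levels; each of the others hosts up to
    three parallel classes, told apart by [slot]. *)
Definition phi (j : J) : P + 'I_N.+1 :=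
  match j with
  | inl cb => if nested cb then inl (Some (cb.1.1, level cb))
              else inr (inord (MT + rank cb %/ 3))
  | inr (inl i) => inl (Some (phiI i))
  | inr (inr (j, _)) => inr (inord (hT j))
  end.

Definition slot (j : J) (e : 'I_3) : 'I_3 :=
  match j with
  | inl cb => inord (rank cb %% 3)
  | inr (inl _) => o0
  | inr (inr (j, _)) => sT j e
  end.

Definition V : {set J} := [set j | if j is inl cb then kept cb else true].

(* Blocks of type A are oriented upwards and blocks of type B downwards, so that a pair of
   points on two levels is covered once in each direction. *)
Lemma dedge_cell c b e : exists a a' : 'I_3, [/\ a != a', (a < a')%N = b &
  dedge (vert (inl (c, b))) (ori (inl (c, b))) e = (Some (vtx b a c, a), Some (vtx b a' c, a'))].
Proof.
case: b; elim/ord3_ind: e; rewrite /dedge /vert /ori /sel3 /=.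
- by exists o1, o2.
- by exists o0, o2.
- by exists o0, o1.
- by exists o2, o1.
- by exists o2, o0.
- by exists o1, o0.
Qed.

Lemma dedge_T j l e : dedge (vert (inr (inr (j, l)))) (ori (inr (inr (j, l)))) e
  = (Some ((dedge (vT j) (oT j) e).1, l), Some ((dedge (vT j) (oT j) e).2, l)).
Proof. by rewrite /dedge /=; case: (oT j e). Qed.

Lemma dedge_I_full x l e : full ->
  let a := dedge (vert (inr (inl (x, l)))) (ori (inr (inl (x, l)))) e in
  [\/ a = (Some (x, l), Some (x + r, l)), a = (None, Some (x, l))
    | a = (Some (x + r, l), None)].
Proof.
by rewrite /dedge /= /oriI => ->; elim/ord3_ind: e; rewrite /sel3 /=;
  [constructor 1|constructor 3|constructor 2].
Qed.

(** The sum of the two levels is recorded because it identifies [l]. *)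
Lemma dedge_I_pi x l e : ~~ full ->
  let a := dedge (vert (inr (inl (x, l)))) (ori (inr (inl (x, l)))) e in
  [\/ exists k k' : 'I_3, [/\ (k < k')%N, k + k' = sel3 1 3 2 l &
        a = (Some (vtx true k (pi x), k), Some (vtx true k' (pi x), k'))],
      a = (None, Some (vtx true l (pi x), l))
    | a = (Some (vtx true (nx l) (pi x), nx l), None)]%N.
Proof.
rewrite /dedge /= /oriI => /negPf->; elim/ord3_ind: e; rewrite /sel3 /=;
  [constructor 1|constructor 3|constructor 2] => //.
elim/ord3_ind: l => /=; [exists o0, o1|exists o1, o2|exists o0, o2]; split=> //.
Qed.

(** * Each ordered pair is a directed edge of at most one block *)

Lemma pair_inj (u v u' v' : P) : (u, v) = (u', v') -> u = u' /\ v = v'.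
Proof. by case. Qed.

Definition de (j : J) := dedge (vert j) (ori j).

Lemma dedge_cell_cell cb cb' e f : de (inl cb) e = de (inl cb') f -> cb = cb'.
Proof.
case: cb cb' => [c b] [c' b']; rewrite /de.
have [a [a' [aa' <- ->]]] := dedge_cell c b e.
have [k [k' [_ <- ->]]] := dedge_cell c' b' f.
move=> H; have [/point_inj[ak h] /point_inj[ak' h']] := pair_inj H.
move: h h'; rewrite -ak -ak' => h h'.
by rewrite (vtx_pair aa' h h').
Qed.

Lemma dedge_cell_T cb jl e f : de (inl cb) e = de (inr (inr jl)) f -> False.
Proof.
case: cb jl => [c b] [j l]; rewrite /de dedge_T.
have [a [a' [aa' _ ->]]] := dedge_cell c b e.
by move=> /pair_inj[/point_inj[al _] /point_inj[a'l _]]; rewrite al a'l eqxx in aa'.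
Qed.

Lemma dedge_T_T jl jl' e f : de (inr (inr jl)) e = de (inr (inr jl')) f -> jl = jl'.
Proof.
case: jl jl' => [j l] [j' l']; rewrite /de !dedge_T.
move=> /pair_inj[/point_inj[-> h] /point_inj[_ h']].
by rewrite (@dedgeT_inj j j' e f) // [LHS]surjective_pairing h h' -surjective_pairing.
Qed.

Lemma dedge_cell_I cb i e f : kept cb -> de (inl cb) e = de (inr (inl i)) f -> False.
Proof.
case: cb i => [c b] [x l] k; rewrite /de.
have [a [a' [aa' ab ->]]] := dedge_cell c b e.
case: (boolP full) => fl.
  case: (dedge_I_full x l f fl) => -> /pair_inj[] // /point_inj[al _] /point_inj[a'l _].
  by rewrite al a'l eqxx in aa'.
case: (dedge_I_pi x l f fl) => [[m [m' [mm' _ ->]]]|->|->] /pair_inj[] //.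
move=> /point_inj[am h] /point_inj[am' h']; move: k h h' ab; rewrite -am -am' in mm' *.
rewrite mm'; case: b => // k h h' _; move: k.
by rewrite (vtx_pair aa' h h') pi_kept (negPf fl).
Qed.

Lemma dedge_I_T i jl e f : de (inr (inl i)) e = de (inr (inr jl)) f -> False.
Proof.
case: i jl => [x l] [j l']; rewrite /de dedge_T.
case: (boolP full) => fl.
  case: (dedge_I_full x l e fl) => -> /pair_inj[] // /point_inj[_ h] /point_inj[_ h'].
  by apply: (@dedgeT_gap fl j f); rewrite -h -h'.
case: (dedge_I_pi x l e fl) => [[m [m' [mm' _ ->]]]|->|->] /pair_inj[] //.
by move=> /point_inj[am h] /point_inj[am' h']; rewrite am am' ltnn in mm'.
Qed.

Lemma dedge_I_I i i' e f : de (inr (inl i)) e = de (inr (inl i')) f -> i = i'.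
Proof.
case: i i' => [x l] [x' l']; rewrite /de; case: (boolP full) => fl.
  case: (dedge_I_full x l e fl) => ->; case: (dedge_I_full x' l' f fl) => ->;
    move=> /pair_inj[] //.
  - by move=> /point_inj[-> ->].
  - by move=> _ /point_inj[-> ->].
  - by move=> /point_inj[-> /addIr->].
have nx_inj m m' : nx m = nx m' -> m = m'.
  by elim/ord3_ind: m; elim/ord3_ind: m'.
case: (dedge_I_pi x l e fl) => [[m [m' [mm' sm ->]]]|->|->];
  case: (dedge_I_pi x' l' f fl) => [[k [k' [kk' sk ->]]]|->|->]; move=> /pair_inj[] //.
- move=> /point_inj[mk h] /point_inj[mk' _]; rewrite -mk -mk' in sk h.
  rewrite (vtx_pi_inj h); congr (_, _); move: sm; rewrite {}sk.
  by elim/ord3_ind: l; elim/ord3_ind: l'.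
- by move=> _ /point_inj[ll']; rewrite ll' => /vtx_pi_inj->.
- by move=> /point_inj[ll'] h _; move: h; rewrite ll' (nx_inj _ _ ll') => /vtx_pi_inj->.
Qed.

Lemma dedge_inj i j e f : i \in V -> j \in V -> de i e = de j f -> i = j.
Proof.
rewrite !inE; case: i j => [cb|[i|jl]] [cb'|[i'|jl']] iV jV h.
- by rewrite (dedge_cell_cell h).
- by case: (dedge_cell_I iV h).
- by case: (dedge_cell_T h).
- by case: (dedge_cell_I jV (esym h)).
- by rewrite (dedge_I_I h).
- by case: (dedge_I_T h).
- by case: (dedge_cell_T (esym h)).
- by case: (dedge_I_T (esym h)).
- by rewrite (dedge_T_T h).
Qed.

(** * Distinct vertices and distinct nesting pairs *)

Lemma vert_inj j : injective (vert j).
Proof.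
have neq3 (S : Type) (a b c : S) : a <> b -> a <> c -> b <> c -> injective (sel3 a b c).
  by move=> ab ac bc m k; elim/ord3_ind: m; elim/ord3_ind: k; rewrite /sel3 //= => h;
     exfalso; first [exact: ab h|exact: ac h|exact: bc h|exact: ab (esym h)
       |exact: ac (esym h)|exact: bc (esym h)].
case: j => [[c b]|[[x l]|[j l]]].
- by move=> m k [].
- rewrite /= /vertI; case: full; apply: neq3 => //.
    move=> /point_inj[_ /eqP]; rewrite -{1}[x]addr0 (inj_eq (addrI x)) eq_sym.
    exact/negP.
  by move=> /point_inj[]; elim/ord3_ind: l.
- by move=> m k /= /point_inj[_]; exact: vT_inj.
Qed.

(** The nesting pairs of the blocks through oo have differences 0, r.1 or - r.1 over [R0]. A nested
    cell can have such a difference only at levels where those blocks do not have it. *)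
Lemma slope_avoid c b a : nested (c, b) -> let s := slope b a c.2.1 in
  [/\ s <> 0, (s = r.1 -> a = o2) & (s = - r.1 -> a = o2 /\ level (c, b) = o2)].
Proof.
move=> nc s; have s0 : s <> 0.
  move=> /slope_eq0 d0; move: nc; rewrite /nested /= /nestA /nestB d0.
  by case: b s; rewrite ?eqxx // => s /andP[/pos_neq0].
split=> // => [|]; move: nc; rewrite /s /nested /level /slope /=; case: b {s s0} => /=.
- case/and4P=> _ h1 h2 h3; elim/ord3_ind: a; rewrite /sel3 //= => h.
    by rewrite h eqxx in h1.
  by rewrite -h opprK eqxx in h2.
- case/and3P=> _ h1 h2; elim/ord3_ind: a; rewrite /sel3 //= => h.
    by rewrite h eqxx in h1.
  by rewrite -h opprK eqxx in h2.
- case/and4P=> _ h1 h2 h3; elim/ord3_ind: a; rewrite /sel3 //= => h.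
  + by rewrite h eqxx in h2.
  + by move/oppr_inj: h h1 => ->; rewrite eqxx.
  + by rewrite h eqxx in h3.
- case/and3P=> _ h1 h2; elim/ord3_ind: a; rewrite /sel3 //= => h.
  + by rewrite h eqxx in h2.
  + by move/oppr_inj: h h1 => ->; rewrite eqxx.
Qed.

Lemma level_cases c b : nested (c, b) ->
  [\/ [/\ b, level (c, b) = o0 & pos c.2.1], [/\ b, level (c, b) = o1 & pos (- c.2.1)]
    | [/\ ~~ b, level (c, b) = o2 & pos c.2.1]].
Proof.
rewrite /nested /level /=; case: b => /= [/andP[d0 _]|/andP[pd _]]; last by constructor 3.
case: (boolP (pos c.2.1)) => pd; first by constructor 1.
by constructor 2; split=> //; apply: posVopp.
Qed.

Let cancel0 (x s : R0) : x = x + s -> s = 0.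
Proof. by move/eqP; rewrite -{1}[x]addr0 (inj_eq (addrI x)) => /eqP. Qed.
Let cancelr (x s t : R0) : x + t = x + s -> s = t.
Proof. by move/addrI. Qed.
Let cancelN (x s t : R0) : x = x + t + s -> s = - t.
Proof. by rewrite -addrA => /cancel0 /eqP; rewrite addrC addr_eq0 => /eqP. Qed.

Lemma slope0 b l : slope b l 0 = 0.
Proof. by have := slopeB b l 0 0; rewrite !subrr. Qed.

Lemma phiI_fst x l : (phiI (x, l)).1.1 =
  if full then sel3 x.1 x.1 (x.1 + r.1) l else sel3 x.1 (x.1 + r.1) (x.1 + r.1) l.
Proof.
by rewrite /phiI; case: full; elim/ord3_ind: l; rewrite /sel3 //= ?rho0 addr0.
Qed.

Lemma phiI_snd x l :
  (phiI (x, l)).2 = if full then sel3 o1 o2 o0 l else sel3 o2 o0 o1 l.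
Proof. by rewrite /phiI; case: full; elim/ord3_ind: l. Qed.

(** Nested cells are kept apart from the blocks through oo by coordinates in [R0] alone, so the
    coordinate in [E] is dropped. *)
Let proj (p : P) := omap (fun p : R * 'I_3 => (p.1.1, p.2)) p.

Lemma vtx_pi_fst b l x : (vtx b l (pi x)).1 = x.1.
Proof. by rewrite /vtx [LHS]/= slope0 addr0. Qed.

Lemma vertI_proj x l e : proj (vertI (x, l) e) =
  if full then sel3 None (Some (x.1, l)) (Some (x.1 + r.1, l)) e
  else sel3 None (Some (x.1, l)) (Some (x.1, nx l)) e.
Proof.
have h k : proj (Some (vtx true k (pi x), k)) = Some (x.1, k).
  refine (congr1 (fun y => Some (y, k)) (vtx_pi_fst true k x)).
by rewrite /vertI; case: full; elim/ord3_ind: e => //; exact: h.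
Qed.

Lemma nest_cell_I c b i e a : nested (c, b) -> phiI i = (c.1, level (c, b)) ->
  vertI i e = Some (vtx b a c, a) -> False.
Proof.
move=> nc pE vE; have [s0 sr sN] := slope_avoid a nc.
have vE1 : proj (vertI i e) = Some (c.1.1 + slope b a c.2.1, a) by rewrite vE.
have pE1 : (phiI i).1.1 = c.1.1 by rewrite pE.
have pE2 : (phiI i).2 = level (c, b) by rewrite pE.
move: pE1 pE2 vE1 sN; clear vE pE.
case: i => [x l]; rewrite phiI_fst phiI_snd vertI_proj; move: s0 sr.
move: (slope b a c.2.1) (level (c, b)) (x.1) => s lv x1 s0 sr.
case: full; elim/ord3_ind: l; elim/ord3_ind: e; rewrite /sel3 //= => <- <- [h ha] sN;
  subst a; first [by move: h => /cancel0/s0 | by move: h => /cancelr/sr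
    | by move: h => /cancelN/sN[]].
Qed.

Lemma nest_I_cell c b i e a : nested (c, b) -> vertI i e = Some (c.1, level (c, b)) ->
  phiI i = (vtx b a c, a) -> False.
Proof.
move=> nc vE pE; have [s0 sr sN] := slope_avoid a nc.
have vE1 : proj (vertI i e) = Some (c.1.1, level (c, b)) by rewrite vE.
have pE1 : (phiI i).1.1 = c.1.1 + slope b a c.2.1 by rewrite pE.
have pE2 : (phiI i).2 = a by rewrite pE.
move: pE1 pE2 vE1 sN; clear vE pE.
case: i => [x l]; rewrite phiI_fst phiI_snd vertI_proj; move: s0 sr.
move: (slope b a c.2.1) (level (c, b)) (x.1) => s lv x1 s0 sr.
case: full; elim/ord3_ind: l; elim/ord3_ind: e; rewrite /sel3 //= => h ha [hm hl] sN;
  subst a; rewrite -{}hm in h; rewrite -{}hl in sN;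
  first [by move: h => /cancel0/s0 | by move: h => /cancelr/sr
    | by move: h => /cancelN/sN[]].
Qed.

(** The two slopes would be opposite; whatever the levels, some element and its opposite would then
    both be [pos]. *)
Lemma nest_cell_cell c b a c' b' a' : nested (c, b) -> nested (c', b') ->
  vtx b a c = c'.1 -> a = level (c', b') -> vtx b' a' c' = c.1 -> a' = level (c, b) -> False.
Proof.
move=> nc nc' h aE h' aE'.
have {h h'} hs : slope b a c.2.1 = - slope b' a' c'.2.1.
  apply/eqP; rewrite -addr_eq0; apply/eqP.
  have /= e1 := congr1 fst h; have /= e2 := congr1 fst h'.
  by move: e2; rewrite -e1 -addrA => /esym/cancel0.
have rho_inj x y : rho x = rho y -> x = y.
  by move=> e; apply/eqP; rewrite -subr_eq0; apply/eqP/rho_eq0; rewrite rhoB e subrr.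
have no x : pos x -> pos (- x) -> False := @pos_opp x.
have := level_cases nc; have := level_cases nc'.
case=> -[bE' lE' p'] [] -[bE lE p]; rewrite aE aE' lE lE' in hs;
  rewrite ?bE ?bE' ?(negPf bE) ?(negPf bE') /slope /sel3 /= ?opprK -?rhoN in hs.
all: try move/rho_inj: hs => hs.
all: try solve [by apply: (no _ p'); rewrite -hs ?opprK | by apply: (no _ p); rewrite hs ?opprK
   | by apply: (no _ p'); rewrite hs ?opprK | by apply: (no _ p); rewrite -hs ?opprK ].
Qed.

Lemma vtx_pi_id a x : a != o2 -> vtx true a (pi x) = x.
Proof.
by case: x => [x y]; elim/ord3_ind: a; rewrite /vtx /sel3 //= ?subr0 ?addr0 ?add0r.
Qed.

Lemma doubleR (x : R) : x + x = 0 -> x = 0.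
Proof. by case: x => [x y] [/double0-> /doubleE->]. Qed.

Lemma phiI_inj : injective phiI.
Proof.
move=> [x l] [x' l']; rewrite /phiI; case: full; elim/ord3_ind: l; elim/ord3_ind: l' => //=;
  rewrite /sel3 /= => /(congr1 fst) e; congr (_, _); first [exact: e | exact: addIr e
  | exact: (vtx_pi_inj (l := o2) e)].
Qed.

(** If [full], the levels alone exclude this; otherwise it forces r = 0 or r + r = 0. *)
Lemma nest_I_I i i' e e' : vertI i e = Some (phiI i') -> vertI i' e' = Some (phiI i) -> False.
Proof.
have rr x : x + r = x -> False.
  by move/eqP; rewrite -{2}[x]addr0 (inj_eq (addrI x)); apply/negP.
have r2 x : x + r + r = x -> False.
  by rewrite -addrA => /eqP; rewrite -{2}[x]addr0 (inj_eq (addrI x)) => /eqP/doubleR/eqP;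
    apply/negP.
case: i i' => [x l] [x' l']; case: (boolP full) => fl.
  by rewrite /phiI /vertI fl; elim/ord3_ind: l; elim/ord3_ind: l'; elim/ord3_ind: e;
    elim/ord3_ind: e'.
have vK y m k z a : vertI (y, m) k = Some (z, a) ->
    a != sel3 o2 o0 o1 m /\ z = vtx true a (pi y).
  rewrite /vertI (negPf fl); elim/ord3_ind: k => // /point_inj[<- <-]; split=> //;
    by elim/ord3_ind: m.
have pK y m : phiI (y, m) = (if m == o0 then vtx true o2 (pi y) else y + r, sel3 o2 o0 o1 m).
  by rewrite /phiI (negPf fl); elim/ord3_ind: m.
have id0 y := @vtx_pi_id o0 y isT; have id1 y := @vtx_pi_id o1 y isT.
rewrite !pK => /vK[la' h] /vK[la h']; move: la la' h h'.
generalize (vtx true) id0 id1 vtx_pi_inj => f f0 f1 f_inj.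
elim/ord3_ind: l; elim/ord3_ind: l' => //=; rewrite /sel3 /= => _ _.
all: rewrite ?f0 ?f1 => h h'.
- by move/f_inj: h' => xx; apply: (rr x'); rewrite h xx.
- by move/f_inj: h' => xx; apply: (rr x'); rewrite h xx.
- by move/f_inj: h => xx; apply: (rr x); rewrite h' xx.
- by apply: (r2 x'); rewrite h.
- by move/f_inj: h => xx; apply: (rr x); rewrite h' xx.
- by apply: (r2 x'); rewrite h.
Qed.

Lemma nested_phi j p : phi j = inl p ->
  (exists c b, [/\ j = inl (c, b), nested (c, b) & p = Some (c.1, level (c, b))]) \/
  (exists i, j = inr (inl i) /\ p = Some (phiI i)).
Proof.
case: j => [[c b]|[i|[j l]]] //=; last by case=> <-; right; exists i.
by case: ifP => // n [<-]; left; exists c, b.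
Qed.

Lemma phi_out j e : phi j <> inl (vert j e).
Proof.
move=> /nested_phi[[c [b [-> nc /point_inj[_ h]]]]|[[x l] [-> h]]].
  have [s0 _ _] := slope_avoid e nc; apply: s0.
  by have /= := congr1 fst h => /esym/cancel0.
move: h; rewrite /= /vertI /phiI; case: full.
  by elim/ord3_ind: l; elim/ord3_ind: e.
by elim/ord3_ind: l; elim/ord3_ind: e => // /point_inj[].
Qed.

Lemma nest_inj i j e f p : phi i = inl p -> phi j = inl p -> vert i e = vert j f -> i = j.
Proof.
move=> /nested_phi[[c [b [-> nc ->]]]|[i' [-> ->]]].
all: move=> /nested_phi[[c' [b' [-> nc' pE]]]|[j' [-> pE]]] vE.
- have [lE cE] := point_inj pE; have [aE vE'] := point_inj vE.
  have bE : b = b'.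
    have := level_cases nc; have := level_cases nc'; move: lE => /= ->.
    by case=> -[hb' -> _]; case=> -[hb // _ _];
      apply/idP/idP; rewrite ?hb ?hb' ?(negPf hb) ?(negPf hb').
  by rewrite -bE -aE in vE' *; rewrite (vtx_center cE vE').
- case: (nest_cell_I (i := j') (e := f) (a := e) nc) => //; first by case: pE.
- case: (nest_cell_I (i := i') (e := e) (a := f) nc') => //; first by case: pE.
- by case: pE => /phiI_inj->.
Qed.

Lemma nest_asym i j e f : phi i = inl (vert j f) -> phi j = inl (vert i e) -> False.
Proof.
move=> /nested_phi[[c [b [-> nc hi]]]|[i' [-> hi]]].
all: move=> /nested_phi[[c' [b' [jE nc' hj]]]|[j' [jE hj]]]; rewrite {}jE in hi hj.
- have [a'E vE'] := point_inj hi; have [aE vE] := point_inj hj.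
  exact: (nest_cell_cell nc nc' vE aE vE' a'E).
- apply: (nest_I_cell (i := j') (e := f) (a := e) nc); first exact: hi.
  by case: hj.
- apply: (nest_I_cell (i := i') (e := e) (a := f) nc'); first exact: hj.
  by case: hi.
- exact: nest_I_I hi hj.
Qed.

(** * Blocks nested at outer points, and the number of blocks *)

Lemma class_pool cb : kept cb -> ~~ nested cb -> class cb \in pool.
Proof. by rewrite inE => k n; apply/andP. Qed.

Lemma host_inj i j e f h : i \in V -> j \in V -> phi i = inr h -> phi j = inr h ->
  slot i e = slot j f -> vert i e = vert j f -> i = j.
Proof.
rewrite !inE.
have rank_lt cb : kept cb -> ~~ nested cb ->
    (rank cb < #|pool|)%N /\ (MT + rank cb %/ 3 < N.+1)%N.
  move=> k n; have lt : (rank cb < #|pool|)%N.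
    by rewrite cardE /rank index_mem mem_enum class_pool.
  by split=> //; move: lt pool_small MT_small; lia.
have inord_inj M m n : (m < M.+1)%N -> (n < M.+1)%N -> inord m = inord n :> 'I_M.+1 -> m = n.
  by move=> hm hn /(congr1 val) /=; rewrite !inordK.
have ltT jj : (hT jj < N.+1)%N by apply: leq_trans MT_small.
have inl_inj x y : inr x = inr y :> P + 'I_N.+1 -> x = y by case.
case: i => [cb|[i|[i l]]] //; case: j => [cb'|[j|[j l']]] //=.
- move=> k k'; case: ifPn => // n /inl_inj<-; case: ifPn => // n' /inl_inj.
  have [lt1 lt2] := rank_lt _ k n; have [lt1' lt2'] := rank_lt _ k' n'.
  move=> /inord_inj-/(_ lt2' lt2) dE /inord_inj-/(_ _ _) mE.
  (* The outer point gives the quotient of the rank by 3, the slot its remainder. *)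
  have rE : rank cb = rank cb' by move: dE mE; rewrite !ltn_mod // => d m; have := m isT isT; lia.
  have cE : class cb = class cb'.
    rewrite -(nth_index (class cb) (s := enum pool) (x := class cb)) ?mem_enum ?class_pool //.
    by rewrite -/(rank cb) rE /rank nth_index // mem_enum class_pool.
  case: cb cb' cE {k k' n n' lt1 lt2 lt1' lt2' dE mE rE} => [c b] [c' b'] [<- dE mE].
  by case/point_inj => <- vE; rewrite (vtx_class dE mE vE).
- move=> k _; case: ifPn => // n /inl_inj<- /inl_inj.
  have [_ lt2] := rank_lt _ k n; move=> /inord_inj-/(_ (ltT j) lt2) hE.
  by have := ltn_ord (hT j); rewrite hE ltnNge leq_addr.
- move=> _ k' /inl_inj<-; case: ifPn => // n /inl_inj.
  have [_ lt2] := rank_lt _ k' n; move=> /inord_inj-/(_ lt2 (ltT i)) hE.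
  by have := ltn_ord (hT i); rewrite -hE ltnNge leq_addr.
- move=> _ _ /inl_inj<- /inl_inj/inord_inj-/(_ (ltT j) (ltT i)) hE sE /point_inj[<- vE].
  by rewrite (hostT_inj (val_inj (esym hE)) sE vE).
Qed.

Lemma card_V : (3 * #|V| = #|{: P}| * #|{: P}|.-1)%N.
Proof.
have VC : #|~: V| = if full then 0%N else #|{: R}|.
  case: (boolP full) => fl.
    by apply/eqP; rewrite cards_eq0 -subset0; apply/subsetP => j;
      rewrite !inE; case: j => // cb; rewrite /kept fl orbT.
  have -> : ~: V = [set inl (pi x, true) | x : R].
    apply/setP => j; rewrite !inE; apply/idP/imsetP => [|[x _ ->]]; last first.
      by rewrite pi_kept.
    case: j => // -[[[m mu] [d nu]] b]; rewrite /kept (negPf fl) /= !negb_or !negbK.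
    by case/and3P => /= -> /eqP-> /eqP->; exists (m, nu).
  by rewrite card_imset // => -[x1 x2] [y1 y2] [-> ->].
have k1 : (1 < #|{: R}|)%N by rewrite (cardD1 (0 : R)) (cardD1 r) !inE r_neq0.
have cP : #|{: P}| = (#|{: R}| * 3).+1 by rewrite card_option !card_prod card_ord.
have cJ : #|{: J}| = (#|{: R}| * #|{: R}| * 2 + (#|{: R}| * 3 + #|JT| * 3))%N.
  by rewrite !card_sum !card_prod card_bool card_ord.
have := cardsC V; rewrite {}VC {}cJ {}cP; move: size_T k1.
move: #|{: R}| #|JT| #|V| => k n m; case: full => /=; nia.
Qed.

Lemma core_weak_nesting w : (w = 3 * #|{: R}| + 1 + N.+1)%N ->
  exists (X : {set 'I_w}) (b : nat) (A : 'I_b -> {set 'I_w}) (phi : 'I_b -> 'I_w),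
    weak_nesting X [set: 'I_w] (3 * #|{: R}| + 1) 3 2 w A phi.
Proof.
have cP : #|{: P}| = (3 * #|{: R}| + 1)%N by rewrite card_option card_prod card_ord mulnC addn1.
rewrite -cP => wE.
apply: (@weak_nesting_assembly P J N.+1 V vert ori phi slot) => //.
- exact: card_V.
- by move=> j _; apply: vert_inj.
- exact: dedge_inj.
- by move=> j e _; apply: phi_out.
- by move=> i j e f p _ _; apply: nest_inj.
- by move=> i j e f _ _; apply: nest_asym.
- exact: host_inj.
Qed.
End Cells.

(** * Triples inside one level *)

(* [n] triples on [S], each carrying one of [M] host labels: a point lies in at most three
   triples with a given label (those are told apart by [s]), every ordered pair of points is
   a directed edge of at most one triple, and the pairs in [gap] are not directed edges. *)
Definition hosted_triples (S : finType) (n M : nat) (gap : S -> S -> Prop) : Prop :=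
  exists (J : finType) (v : J -> 'I_3 -> S) (o : J -> 'I_3 -> bool)
         (h : J -> 'I_M) (s : J -> 'I_3 -> 'I_3),
  [/\ #|J| = n, (forall j, injective (v j)),
      (forall i j e f, dedge (v i) (o i) e = dedge (v j) (o j) f -> i = j),
      (forall i j e f, h i = h j -> s i e = s j f -> v i e = v j f -> i = j) &
      (forall j e, ~ gap (dedge (v j) (o j) e).1 (dedge (v j) (o j) e).2)].

(** The map [f] need not be additive: without a gap, the triples can be moved to any group of the
    same order. *)
Lemma hosted_triples_transport (S S' : finType) n M gap gap' (f : S -> S') :
  injective f -> (forall x y, gap' (f x) (f y) -> gap x y) ->
  hosted_triples n M gap -> hosted_triples (S := S') n M gap'.
Proof.
move=> f_inj fgap [J [v [o [h [s [cJ vi di hi gi]]]]]].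
have dE j e : dedge (fun l => f (v j l)) (o j) e
    = (f (dedge (v j) (o j) e).1, f (dedge (v j) (o j) e).2).
  by rewrite /dedge; case: (o j e).
exists J, (fun j l => f (v j l)), o, h, s; split=> //.
- by move=> j l l' /f_inj/vi.
- move=> i j e e'; rewrite !dE => -[/f_inj h1 /f_inj h2]; apply: (di _ _ e e').
  by rewrite [LHS]surjective_pairing h1 h2 -surjective_pairing.
- by move=> i j e e' h1 h2 /f_inj; apply: hi.
- by move=> j e; rewrite dE => /fgap; apply: gi.
Qed.

(** * Cyclic development of difference triples *)

Section Cyclic.
Variables (k' : nat) (I0 : finType) (p d : I0 -> nat) (flip : I0 -> bool).
Local Notation k := k'.+1.

(** The directed differences of the base triple {0, p, p + d}. Reversing the edge of difference d by
    [flip] lets two base triples share d. *)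
Definition label (i : I0) (e : 'I_3) : nat :=
  sel3 (if flip i then k - d i else d i)%N (p i + d i)%N (p i) e.

(** Distinct labels keep the directed edges distinct. An orbit has its own host and contains each
    point once at each vertex position, which serves as slot. *)
Lemma cyclic_triples (g : nat) :
  (forall i, 0 < d i < k)%N -> (forall i e, 0 < label i e < k)%N ->
  (forall i i' e e', label i e = label i' e' -> i = i' /\ e = e') ->
  (forall i e, label i e != g) -> (g < k)%N ->
  hosted_triples (S := 'I_k) (#|I0| * k) #|I0| (fun u w => w = u + inZp g).
Proof.
move=> d_lt lab_lt lab_inj lab_g g_lt.
pose v (j : I0 * 'I_k) := sel3 j.2 (j.2 + inZp (p j.1)) (j.2 + inZp (p j.1) + inZp (d j.1)).
pose o (j : I0 * 'I_k) (e : 'I_3) := sel3 (~~ flip j.1) false true e.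
have inZpD m n : inZp m + inZp n = inZp (m + n) :> 'I_k.
  by apply: val_inj; rewrite /= modnDm.
have inZp_inj m n : (m < k)%N -> (n < k)%N -> inZp m = inZp n :> 'I_k -> m = n.
  by move=> hm hn /(congr1 val) /=; rewrite !modn_small.
have inZp_neq0 m : (0 < m < k)%N -> inZp m != 0 :> 'I_k.
  move=> /andP[m0 mk]; rewrite -val_eqE /= modn_small //; lia.
have vE j e : dedge (v j) (o j) e = ((dedge (v j) (o j) e).1,
    (dedge (v j) (o j) e).1 + inZp (label j.1 e)).
  rewrite /dedge /o /v /label; elim/ord3_ind: e; rewrite /sel3 /=.
  - case: (flip j.1) => //=; rewrite -(addrA (j.2 + _)) inZpD subnKC; last first.
      by case/andP: (d_lt j.1) => _ /ltnW.
    by rewrite (_ : inZp k = 0) ?addr0 //; apply: val_inj; rewrite /= modnn.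
  - by rewrite -inZpD addrA.
  - by [].
exists (I0 * 'I_k)%type, v, o, (fun j => enum_rank j.1), (fun _ e => e); split.
- by rewrite card_prod card_ord.
- move=> [i x]; have n0 := inZp_neq0 _ (lab_lt i _).
  have h (y z : 'I_k) : z != 0 -> y = y + z -> False.
    by move=> /eqP z0 /eqP; rewrite -{1}[y]addr0 (inj_eq (addrI y)) => /eqP/esym.
  have h0 := inZp_neq0 _ (d_lt i).
  have := n0 o2; have := n0 o1; rewrite /label /sel3 /= -inZpD => h1 h2.
  move=> e e'; elim/ord3_ind: e; elim/ord3_ind: e'; rewrite /v /sel3 //= => hE; exfalso;
    first [exact: (h _ _ h0 hE) | exact: (h _ _ h0 (esym hE)) | exact: (h _ _ h2 hE)
      | exact: (h _ _ h2 (esym hE)) | by rewrite -addrA in hE; exact: (h _ _ h1 hE)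
      | by rewrite -addrA in hE; exact: (h _ _ h1 (esym hE))].
- move=> [i x] [i' x'] e e'; rewrite vE [RHS]vE => hE.
  have h1 := congr1 fst hE; have h2 := congr1 snd hE; clear hE.
  move: h1 h2; rewrite [LHS]/= [RHS]/= => h1; rewrite [LHS]/= [RHS]/= => h2.
  move: h2; rewrite h1 => /addrI/inZp_inj h2.
  have [ii' ee'] : i = i' /\ e = e'.
    have /andP[_ l1] := lab_lt i e; have /andP[_ l2] := lab_lt i' e'.
    exact: lab_inj (h2 l1 l2).
  move: h1; rewrite /= -ii' -ee' /dedge /v /o; elim/ord3_ind: e {ee' h2}; rewrite /sel3 /=;
    [case: (flip i) => /= | | ]; rewrite -?addrA; first [by move/addIr-> | by move=> ->].
- by move=> [i x] [i' x'] e e' /= /enum_rank_inj<- <-; rewrite /v /sel3 /=;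
    elim/ord3_ind: e => /=; rewrite -?addrA; first [by move=> -> | by move/addIr->].
- move=> j e; rewrite vE => hE; have /andP[_ lt] := lab_lt j.1 e.
  by have := lab_g j.1 e; rewrite (inZp_inj _ _ lt g_lt (addrI _ hE)) eqxx.
Qed.
End Cyclic.

(** * A twofold Skolem-type family of difference triples *)

Section Labels.
Variables (q : nat) (eps : bool).
Hypothesis q_gt0 : (0 < q)%N.

Let s1 := (2 * q + 1 + eps)%N.
Let s2 := (4 * q + 1 + 2 * eps)%N.
Let s3 := (6 * q + 1 + 3 * eps)%N.

(* The difference triples are d, p, p + d for d = 1, ..., 2q, each d occurring twice: the
   pairs {p, p + d} tile an interval, by nesting the odd differences around a common centre
   (once at s1 and once at s2), and by nesting the even differences around two centres at
   distance 2q, which are joined by the second copy of the difference 2q (from s3 on). *)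
Definition skolem_pos (d : nat) (c : bool) : nat :=
  if odd d then ((if c then s2 else s1) + q - uphalf d)%N
  else if ~~ c then (s3 + q - d./2)%N
  else if (d < 2 * q)%N then (s3 + 3 * q - d./2)%N else (s3 + q)%N.

(** If [eps], the intervals of labels miss exactly 2q + 1, 4q + 2, 6q + 3 and 10q + 4. The first
    three form the additional triple; the last is left to the blocks through oo. *)
Definition base : finType := ('I_(2 * q) * bool + 'I_eps)%type.
Definition base_d (i : base) : nat := if i is inl (d, _) then d.+1 else (4 * q + 2)%N.
Definition base_p (i : base) : nat :=
  if i is inl (d, c) then skolem_pos d.+1 c else (2 * q + 1)%N.
Definition base_flip (i : base) : bool := if i is inl (_, c) then c else false.

Local Notation k := (12 * q + 1 + 4 * eps)%N.

(** Halves and parities are replaced by linear equations in j, the rank of [d] among the odd or the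
    even differences, ready for [lia]. *)
Lemma skolem_posP (d : nat) (c : bool) : (0 < d <= 2 * q)%N -> exists j : nat,
  let p := skolem_pos d c in (0 < j <= q)%N /\
  [\/ [/\ c = 0 :> nat, d + 1 = 2 * j & p + j = s1 + q],
      [/\ c = 0 :> nat, d = 2 * j & p + j = s3 + q],
      [/\ c = 1 :> nat, d + 1 = 2 * j & p + j = s2 + q]
    | [/\ c = 1 :> nat, d = 2 * j & if j < q then p + j = s3 + 3 * q else p = s3 + q]]%N.
Proof.
move=> hd; rewrite /skolem_pos; case: (boolP (odd d)) => od.
  exists (uphalf d); split; first lia.
  by case: c => /=; [constructor 3|constructor 1]; split=> //; lia.
exists d./2; split; first lia.
case: c => /=; [constructor 4|constructor 2]; split=> //; try lia.
have -> : (d < 2 * q)%N = (d./2 < q)%N by apply/idP/idP; lia.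
by case: ifP => h; rewrite h //; lia.
Qed.

Ltac skolem_cases h j :=
  case: h => j [?]; case=> -[? ? h]; last (move: h; case: (ltnP j q) => ? h).

Lemma label_lt i e : (0 < label k.-1 base_p base_d base_flip i e < k)%N.
Proof.
case: i => [[d c]|[i lti]]; last first.
  rewrite /label /base_p /base_d /base_flip /=; elim/ord3_ind: e; rewrite /sel3 /=;
    move: lti; case: eps => /=; lia.
have hd : (0 < d.+1 <= 2 * q)%N by case: d.
rewrite /label /base_p /base_d /base_flip.
have := skolem_posP c hd; move: (skolem_pos _ _) => p; rewrite /s1 /s2 /s3 => h.
by skolem_cases h j; elim/ord3_ind: e; rewrite /sel3 /=; try (case: (c)); lia.
Qed.

Lemma label_gap i e : eps -> label k.-1 base_p base_d base_flip i e != (10 * q + 4)%N.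
Proof.
case: i => [[d c]|[i lti]] => [|he]; last first.
  rewrite /label /base_p /base_d /base_flip; elim/ord3_ind: e; rewrite /sel3 /=; lia.
have hd : (0 < d.+1 <= 2 * q)%N by case: d.
rewrite /label /base_p /base_d /base_flip => he.
have := skolem_posP c hd; move: (skolem_pos _ _) => p; rewrite /s1 /s2 /s3 he => h.
by skolem_cases h j; elim/ord3_ind: e; rewrite /sel3 /=; try (case: (c)); lia.
Qed.

Lemma label_inj i i' e e' : label k.-1 base_p base_d base_flip i e =
  label k.-1 base_p base_d base_flip i' e' -> i = i' /\ e = e'.
Proof.
have inl_case (d d' : 'I_(2 * q)) (c c' : bool) : d = d' :> nat /\ c = c' :> nat /\ e = e' :> nat ->
    inl (d, c) = inl (d', c') :> base /\ e = e'.
  case=> /val_inj-> [cc' /val_inj->]; split=> //; congr (inl (_, _)).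
  by case: c c' cc' => [] [].
have hd (d : 'I_(2 * q)) : (0 < d.+1 <= 2 * q)%N by case: d.
rewrite /label /base_p /base_d /base_flip.
case: i => [[d c]|i]; case: i' => [[d' c']|i'].
- have := skolem_posP c (hd d); move: (skolem_pos _ _) => p; rewrite /s1 /s2 /s3 => h.
  have := skolem_posP c' (hd d'); move: (skolem_pos _ _) => p'; rewrite /s1 /s2 /s3 => h'.
  move=> lE; apply: inl_case; move: lE (hd d) (hd d') h h'.
  have eps1 : (eps <= 1)%N by case: eps.
  move: (nat_of_ord d) (nat_of_ord d') (nat_of_bool eps) eps1 => {}d {}d' u u1; clear - u1.
  elim/ord3_ind: e; elim/ord3_ind: e'; rewrite /sel3 /= => lE hd hd' h h'.
  + move: lE; clear - u1 hd hd'; case: c; case: c' => /=; lia.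
  + skolem_cases h' j'; move: lE; case: (c) => /=; clear h; lia.
  + skolem_cases h' j'; move: lE; case: (c) => /=; clear h; lia.
  + skolem_cases h j; move: lE; case: (c') => /=; clear h'; lia.
  + skolem_cases h j; skolem_cases h' j'; lia.
  + skolem_cases h j; skolem_cases h' j'; lia.
  + skolem_cases h j; move: lE; case: (c') => /=; clear h'; lia.
  + skolem_cases h j; skolem_cases h' j'; lia.
  + skolem_cases h j; skolem_cases h' j'; lia.
- have := skolem_posP c (hd d); move: (skolem_pos _ _) => p; rewrite /s1 /s2 /s3 => h.
  move=> lE; exfalso; move: lE (hd d) h; case: i' => m; case: (eps) => // _.
  move: (nat_of_ord d) => {}d; clear.
  elim/ord3_ind: e; elim/ord3_ind: e'; rewrite /sel3 /= => lE hd h;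
    skolem_cases h j; move: lE; try (case: (c) => /=); lia.
- have := skolem_posP c' (hd d'); move: (skolem_pos _ _) => p; rewrite /s1 /s2 /s3 => h.
  move=> lE; exfalso; move: lE (hd d') h; case: i => m; case: (eps) => // _.
  move: (nat_of_ord d') => {}d'; clear.
  elim/ord3_ind: e; elim/ord3_ind: e'; rewrite /sel3 /= => lE hd h;
    skolem_cases h j; move: lE; try (case: (c') => /=); lia.
- move=> lE; clear inl_case; have -> : i = i'.
    by apply: val_inj; case: i i' {lE} => m mlt [n nlt] /=; move: mlt nlt; case: (eps); lia.
  split=> //; move: lE; elim/ord3_ind: e; elim/ord3_ind: e'; rewrite /sel3 /= => lE //;
    exfalso; lia.
Qed.
End Labels.

Lemma cyclic_design (q K : nat) (eps : bool) : (0 < q)%N -> (K.+1 = 12 * q + 1 + 4 * eps)%N ->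
  hosted_triples (S := 'I_K.+1) ((4 * q + eps) * K.+1) (4 * q + eps)
    (fun u w => eps /\ w = u + inZp (10 * q + 4)).
Proof.
move=> q0 kE; have cB : #|{: base q eps}| = (4 * q + eps)%N.
  by rewrite card_sum card_prod !card_ord card_bool; lia.
(* Without [eps] the value 0 is a dummy gap: labels are positive. *)
pose g := (if eps then 10 * q + 4 else 0)%N.
have [gT gF] : (eps -> g = 10 * q + 4)%N /\ (~~ eps -> g = 0)%N by rewrite /g; case: (eps).
have g_lt : (g < K.+1)%N by rewrite kE /g; case: (eps); lia.
rewrite -{1 2}cB.
apply: (@hosted_triples_transport _ _ _ _ (fun u w => w = u + inZp g) _ id) => //.
  by move=> x y [/gT-> ->].
have hK : (K = (12 * q + 1 + 4 * eps).-1)%N by rewrite -kE.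
have ltK i e : (0 < label K (@base_p q eps) (@base_d q eps) (@base_flip q eps) i e < K.+1)%N.
  by rewrite hK prednK ?label_lt -?kE.
apply: (@cyclic_triples K (base q eps) (@base_p q eps) (@base_d q eps) (@base_flip q eps)).
- by case=> [[d c]|[i lti]] /=; rewrite kE; [have := ltn_ord d|]; lia.
- exact: ltK.
- by rewrite hK => *; apply: label_inj.
- move=> i e; have [he|he] : eps \/ ~~ eps by case: (eps); [left|right].
    by rewrite hK gT // label_gap.
  by rewrite gF // -lt0n; case/andP: (ltK i e).
- exact: g_lt.
Qed.

(** * Two copies of the Bose triple system *)

Section Bose.
Variable M : nat.
Local Notation m := M.+1.
Hypothesis odd_m : odd m.

Lemma ord_double0 (x : 'I_m) : x + x = 0 -> x = 0.
Proof.
move=> /(congr1 val) /= /eqP h; apply: val_inj => /=; apply/eqP; move: h.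
rewrite -/(dvdn _ _) addnn -mul2n Gauss_dvdr ?coprimen2 // => h.
by case: (x : nat) (ltn_ord x) h => // n ltn /dvdn_leq; lia.
Qed.

(* The shift x of a Bose triple runs over all nonzero elements; x and - x give the same
   block, which yields the two copies. *)
Let J := (('I_M * ('I_m * 'I_3)) + 'I_m * bool)%type.
Let v (j : J) : 'I_3 -> 'I_m * 'I_3 :=
  match j with
  | inl (y, (p, l)) => let x := lift ord0 y in sel3 (p + x, l) (p - x, l) (p, nx l)
  | inr (p, _) => fun l => (p, l)
  end.
Let o (j : J) (e : 'I_3) : bool := if j is inr (_, c) then c else false.

(** One host for each shift, whose blocks meet each point once per vertex position; the last host
    takes both copies of the triples {p} x 'I_3. *)
Let h (j : J) : 'I_m := match j with inl (y, _) => inord y | inr _ => ord_max end.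
Let s (j : J) (e : 'I_3) : 'I_3 := match j with inl _ => e | inr (_, c) => if c then o0 else o1 end.

(** Every triple is oriented cyclically, and its two copies in opposite directions: passing from x
    to - x exchanges the first two vertices. *)
Lemma bose_design : hosted_triples (S := ('I_m * 'I_3)%type)
  (M * m * 3 + m * 2) m (fun _ _ => False).
Proof.
have opp0 (x : 'I_m) : x = - x -> x = 0 by move=> xE; apply: ord_double0; rewrite {1}xE addNr.
have x0 (y : 'I_M) : lift ord0 y != 0 :> 'I_m by rewrite -val_eqE.
have nx_neq l : nx l <> l by elim/ord3_ind: l.
have nx2_neq l : nx (nx l) <> l by elim/ord3_ind: l.
have nx_inj l l' : nx l = nx l' -> l = l' by elim/ord3_ind: l; elim/ord3_ind: l'.
have dfull y p l e : [\/ dedge (v (inl (y, (p, l)))) (o (inl (y, (p, l)))) e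
      = ((p, nx l), (p - lift ord0 y, l)),
    dedge (v (inl (y, (p, l)))) (o (inl (y, (p, l)))) e = ((p + lift ord0 y, l), (p, nx l))
   | dedge (v (inl (y, (p, l)))) (o (inl (y, (p, l)))) e
      = ((p - lift ord0 y, l), (p + lift ord0 y, l))].
  by elim/ord3_ind: e; [constructor 1|constructor 2|constructor 3].
have dshort p c e : exists l, dedge (v (inr (p, c))) (o (inr (p, c))) e =
    if c then ((p, l), (p, nx l)) else ((p, nx l), (p, l)).
  by elim/ord3_ind: e; [exists o1|exists o2|exists o0]; case: c.
have eq_opp_add (z z' x x' : 'I_m) : z - x = z' - x' -> z + x = z' + x' -> x = x' /\ z = z'.
  move=> h1 h2; have zz : z = z'.
    apply/eqP; rewrite -subr_eq0; apply/eqP/ord_double0.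
    have dbl a b : a + a = (a - b) + (a + b) :> 'I_m by rewrite addrACA addNr addr0.
    by rewrite addrACA -opprD (dbl z x) h1 h2 -dbl subrr.
  by move: h2; rewrite zz => /addrI.
have shift_neq (z x : 'I_m) : x != 0 -> z + x <> z.
  by move=> /eqP xn0 /eqP; rewrite -{2}[z]addr0 (inj_eq (addrI z)) => /eqP.
have shiftN_neq (z x : 'I_m) : x != 0 -> z - x <> z.
  by rewrite -oppr_eq0; apply: shift_neq.
have pm_neq (z x : 'I_m) : x != 0 -> z + x <> z - x.
  by move=> /eqP xn0 /addrI/opp0.
have quad (a a' c c' : 'I_m) (b b' d d' : 'I_3) : ((a, b), (c, d)) = ((a', b'), (c', d')) ->
  [/\ a = a', b = b', c = c' & d = d'] by case=> -> -> -> ->.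
have snd2 (a b : 'I_m) (c d : 'I_3) : (a, c) = (b, d) -> a = b /\ c = d by case.
exists J, v, o, h, s; split.
- by rewrite card_sum !card_prod card_bool !card_ord; lia.
- case=> [[y [p l]]|[p c]]; last by move=> a b [].
  have n0 := x0 y; have nl := nx_neq l.
  move=> a b; rewrite /v; elim/ord3_ind: a; elim/ord3_ind: b; rewrite /sel3 //= => /snd2[h1 h2];
    exfalso; first [exact: pm_neq n0 h1 | exact: pm_neq n0 (esym h1) | exact: nl h2
    | exact: nl (esym h2)].
- case=> [[y [p l]]|[p c]] [[y' [p' l']]|[p' c']] e f.
  + have n0 := x0 y; have n0' := x0 y'.
    case: (dfull y p l e) => ->; case: (dfull y' p' l' f) => -> /quad[h1 h2 h3 h4].
    * move: h3; rewrite h1 => /addrI/oppr_inj/lift_inj->; by rewrite h4.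
    * by move: h2 h4; clear; elim/ord3_ind: l; elim/ord3_ind: l'.
    * by move: h2 h4; clear; elim/ord3_ind: l; elim/ord3_ind: l'.
    * by move: h2 h4; clear; elim/ord3_ind: l; elim/ord3_ind: l'.
    * by move: h1; rewrite h3 h2 => /addrI/lift_inj->.
    * by move: h2 h4; clear; elim/ord3_ind: l; elim/ord3_ind: l'.
    * by move: h2 h4; clear; elim/ord3_ind: l; elim/ord3_ind: l'.
    * by move: h2 h4; clear; elim/ord3_ind: l; elim/ord3_ind: l'.
    * by have [/lift_inj-> ->] := eq_opp_add _ _ _ _ h1 h3; rewrite h2.
  + have n0 := x0 y; have [l' ->] := dshort p' c' f.
    case: (dfull y p l e) => ->; case: c' => /quad[h1 h2 h3 h4].
    * by case: (shiftN_neq p _ n0); rewrite h3 h1.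
    * by case: (shiftN_neq p _ n0); rewrite h3 h1.
    * by case: (shift_neq p _ n0); rewrite h1 h3.
    * by case: (shift_neq p _ n0); rewrite h1 h3.
    * by move: h2 h4; clear; elim/ord3_ind: l; elim/ord3_ind: l'.
    * by move: h2 h4; clear; elim/ord3_ind: l; elim/ord3_ind: l'.
  + have n0 := x0 y'; have [l ->] := dshort p c e.
    case: (dfull y' p' l' f) => ->; case: c => /quad[h1 h2 h3 h4].
    * by case: (shiftN_neq p' _ n0); rewrite -h3 -h1.
    * by case: (shiftN_neq p' _ n0); rewrite -h3 -h1.
    * by case: (shift_neq p' _ n0); rewrite -h1 -h3.
    * by case: (shift_neq p' _ n0); rewrite -h1 -h3.
    * by move: h2 h4; clear; elim/ord3_ind: l; elim/ord3_ind: l'.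
    * by move: h2 h4; clear; elim/ord3_ind: l; elim/ord3_ind: l'.
  + have [l ->] := dshort p c e; have [l' ->] := dshort p' c' f.
    case: c; case: c' => /quad[-> h2 h3 h4] //.
    * by move: h2 h4; clear; elim/ord3_ind: l; elim/ord3_ind: l'.
    * by move: h2 h4; clear; elim/ord3_ind: l; elim/ord3_ind: l'.
- have hne (y : 'I_M) : inord y <> ord_max :> 'I_m.
    by move=> /(congr1 val) /=; rewrite inordK ?ltnS ?(ltnW (ltn_ord y)) // => yM;
      have := ltn_ord y; rewrite yM ltnn.
  case=> [[y [p l]]|[p c]] [[y' [p' l']]|[p' c']] e f; rewrite /h /s.
  + move=> /(congr1 val) /=; rewrite !inordK ?ltnS ?(ltnW (ltn_ord _)) // => /val_inj<- <-.
    rewrite /v; elim/ord3_ind: e; rewrite /sel3 [val _]/= => /snd2[].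
    * by move=> /addIr-> ->.
    * by move=> /addIr-> ->.
    * by move=> -> /nx_inj->.
  + by move=> /hne.
  + by move=> /esym/hne.
  + by move=> _; case: c; case: c' => // _ [->].
- by move=> j e [].
Qed.
End Bose.

(** * Choice of the group *)

Lemma weak_nesting_of_triples (R0 E : finZmodType) (rho : R0 -> R0) (r : R0 * E)
    (full : bool) (n M N : nat) :
  {morph rho : x y / x - y} -> (forall x : R0, x + x = 0 -> x = 0) ->
  (forall x : E, x + x = 0 -> x = 0) -> (forall x, rho x = 0 -> x = 0) ->
  (forall x, rho x = x -> x = 0) -> (forall x, rho x = - x -> x = 0) -> r != 0 ->
  hosted_triples (S := (R0 * E)%type) n M (fun u w => full /\ w = u + r) ->
  (3 * n = #|{: R0 * E}| * (#|{: R0 * E}| - 1 - full))%N ->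
  (#|E| * (#|R0| + 3 + 8 * (r.1 != 0%R)) <= 2 * ~~ full + 6 * (N.+1 - M))%N ->
  (M <= N.+1)%N ->
  forall v w, (v = 3 * #|{: R0 * E}| + 1)%N -> (w = v + N.+1)%N ->
  exists (X : {set 'I_w}) (b : nat) (A : 'I_b -> {set 'I_w}) (phi : 'I_b -> 'I_w),
    weak_nesting X [set: 'I_w] v 3 2 w A phi.
Proof.
move=> rhoB d0 dE rho_eq0 rho_fix rho_opp r0 [J [vT [o [h [s [cJ vi di hi gi]]]]]].
move=> size_n poolE MN v w -> ->.
apply: (@core_weak_nesting R0 E rho rhoB d0 dE rho_eq0 rho_fix rho_opp r full r0
  J vT o M h s _ _ _ _ _ N) => //.
- by rewrite cJ.
- by move=> fl j e wE; apply: (gi j e).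
- have poolP := card_pool rhoB d0 rho_eq0 r full.
  have := leq_trans poolP poolE.
  by rewrite addnC leq_add2l -[6%N]/(2 * 3)%N -mulnA leq_pmul2l.
Qed.

(** Here t = 3q + eps and k = 12q + 1 + 4 eps is prime to 3. With rho the doubling, rho - 1 is the
    identity and rho + 1 the multiplication by 3. *)
Lemma weak_nesting_mod3_01 (q : nat) (eps : bool) (w : nat) : (0 < q)%N ->
  (w = 42 * q + 6 + 14 * eps)%N ->
  exists (X : {set 'I_w}) (b : nat) (A : 'I_b -> {set 'I_w}) (phi : 'I_b -> 'I_w),
    weak_nesting X [set: 'I_w] (36 * q + 4 + 12 * eps) 3 2 w A phi.
Proof.
move=> q0 wE; have [K kE] : exists K, (K.+1 = 12 * q + 1 + 4 * eps)%N.
  by exists (12 * q + 4 * eps)%N; lia.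
have oddK : odd K.+1 by rewrite kE; case: (eps); lia.
pose gn := (if eps then 10 * q + 4 else 1)%N; pose g : 'I_K.+1 := inZp gn.
have [gn_gt0 gn_lt] : (0 < gn /\ gn < K.+1)%N by rewrite /gn kE; case: (eps); lia.
have g0 : g != 0 by rewrite -val_eqE /= modn_small // -lt0n.
have dbl := @ord_double0 K oddK.
have triple0 (x : 'I_K.+1) : x + x = - x -> x = 0.
  move=> /eqP; rewrite -addr_eq0 => /eqP /(congr1 val) /= /eqP; rewrite modnDml => hx.
  have {}hx : (K.+1 %| 3 * x)%N by rewrite /dvdn (_ : (3 * x = x + x + x)%N) //; lia.
  move: hx; rewrite Gauss_dvdr; last by rewrite kE; case: (eps);
    rewrite coprime_sym prime_coprime //; lia.
  by move=> hx; apply: val_inj => /=; case: (x : nat) (ltn_ord x) hx => // n ltn /dvdn_leq; lia.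
have cR : #|{: 'I_K.+1 * 'I_1}| = K.+1 by rewrite card_prod !card_ord muln1.
apply: (@weak_nesting_of_triples _ _ (fun x : 'I_K.+1 => x + x) (g, 0 : 'I_1) eps
  ((4 * q + eps) * K.+1) (4 * q + eps) (6 * q + 1 + 2 * eps)) => //.
- by move=> x y; rewrite opprD addrACA.
- by move=> x _; apply: val_inj; case: x => [[]].
- by move=> x /eqP; rewrite -{3}[x]addr0 (inj_eq (addrI x)) => /eqP.
- by apply: contra_neq g0 => /(congr1 fst).
- apply: (hosted_triples_transport (f := fun x => (x, 0 : 'I_1)) _ _ (cyclic_design q0 kE)).
    by move=> x y /(congr1 fst).
  by move=> x y [he] /(congr1 fst) yE; split=> //; move: yE; rewrite /g /gn he.
- by rewrite cR kE; case: (eps); lia.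
- by rewrite /= g0 !card_ord kE; case: (eps); lia.
- by case: (eps); lia.
- by rewrite cR kE; case: (eps); lia.
- by rewrite wE; case: (eps); lia.
Qed.

(* The square factor [m ^ 2] carries the multiplication by [i] on Gaussian integers. *)
Lemma odd_decomposition (k : nat) : odd k -> exists e m n : nat,
  [/\ (k = n.+1 * (m.+1 * m.+1) * e.+1)%N, e = 0%N \/ e = 2%N, odd m.+1, odd n.+1
    & coprime 3 n.+1].
Proof.
move=> odd_k; have k0 : (0 < k)%N by case: k odd_k.
have [n cop kE] := pfactor_coprime (isT : prime 3) k0.
set a := logn 3 k in kE.
have n0 : (0 < n)%N by case: n kE {cop} => // kE; rewrite kE in k0.
have odd3 j : odd (3 ^ j) by rewrite oddX orbT.
have m0 : (0 < 3 ^ (a./2))%N by rewrite expn_gt0.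
exists (if odd a then 2 else 0), (3 ^ (a./2)).-1, n.-1.
rewrite !prednK //; split=> //; last 1 first.
- by move: odd_k; rewrite kE oddM => /andP[].
- rewrite -expnD addnn {1}kE -mulnA; congr muln.
  by rewrite -{1}(odd_double_half a) expnD mulnC; case: (odd a).
- by case: odd; [right|left].
Qed.

(** Here t = 3q + 2 and k = 12q + 9. On the square factor rho squares to - 1, so rho x = x or rho x
    = - x gives x = - x, hence x = 0 in odd order. *)
Lemma weak_nesting_mod3_2 (q w : nat) : (w = 42 * q + 34)%N ->
  exists (X : {set 'I_w}) (b : nat) (A : 'I_b -> {set 'I_w}) (phi : 'I_b -> 'I_w),
    weak_nesting X [set: 'I_w] (36 * q + 28) 3 2 w A phi.
Proof.
move=> wE; have odd_k : odd (12 * q + 9) by lia.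
have [e [m [n [kE eE odd_m odd_n cop]]]] := odd_decomposition odd_k.
pose R0 : finZmodType := ('I_n.+1 * ('I_m.+1 * 'I_m.+1))%type.
pose rho (x : R0) : R0 := (x.1 + x.1, (- x.2.2, x.2.1)).
have dm := @ord_double0 m odd_m; have dn := @ord_double0 n odd_n.
have cR0 : #|R0| = (n.+1 * (m.+1 * m.+1))%N by rewrite !card_prod !card_ord.
have cR : #|{: R0 * 'I_e.+1}| = (12 * q + 9)%N by rewrite card_prod cR0 card_ord kE.
have triple0 (x : 'I_n.+1) : x + x = - x -> x = 0.
  move=> /eqP; rewrite -addr_eq0 => /eqP /(congr1 val) /= /eqP; rewrite modnDml => hx.
  have {}hx : (n.+1 %| 3 * x)%N by rewrite /dvdn (_ : (3 * x = x + x + x)%N) //; lia.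
  move: hx; rewrite Gauss_dvdr; last by rewrite coprime_sym.
  by move=> hx; apply: val_inj => /=; case: (x : nat) (ltn_ord x) hx => // j ltj /dvdn_leq; lia.
have fix0 (x : 'I_n.+1) : x + x = x -> x = 0.
  by move=> /eqP; rewrite -{3}[x]addr0 (inj_eq (addrI x)) => /eqP.
have odd_e : odd e.+1 by case: eE => ->.
have pairE (x y : R0) : x.1 = y.1 -> x.2.1 = y.2.1 -> x.2.2 = y.2.2 -> x = y.
  by case: x y => [? [? ?]] [? [? ?]] /= -> -> ->.
(* If [E] has order 3, the exceptions due to r.1 != 0 would count three times and overfill the outer
   points, so r is taken inside [E]. If [E] is trivial, they are affordable, with equality in the
   bound on the pool. *)
have [r r_neq0 r_e] : exists2 r : R0 * 'I_e.+1, r != 0 & e = 2%N -> r.1 = 0.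
  case: eE => eE; last first.
    exists (0, inZp 1) => //; apply/negP => /eqP /(congr1 snd) /(congr1 val) /=.
    by rewrite modn_small // eE.
  have : (1 < #|R0|)%N by rewrite cR0; move: kE; rewrite eE muln1 => <-; lia.
  rewrite (cardD1 0) inE ltnS => /card_gt0P[x]; rewrite !inE => /andP[x0 _].
  by exists (x, 0) => [|eE']; [apply: contra_neq x0 => /(congr1 fst) | rewrite eE' in eE].
(* Both sides have order 12q + 9; a bare injection is enough, as there is no gap to respect. *)
have cS : (#|{: 'I_(4 * q + 2).+1 * 'I_3}| <= #|{: R0 * 'I_e.+1}|)%N.
  by rewrite cR card_prod !card_ord; lia.
pose f x : R0 * 'I_e.+1 := enum_val (widen_ord cS (enum_rank x)).
have f_inj : injective f.
  by move=> x y /enum_val_inj /(congr1 val) /= /val_inj /enum_rank_inj.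
apply: (@weak_nesting_of_triples R0 'I_e.+1 rho r false
  ((4 * q + 2) * (4 * q + 2).+1 * 3 + (4 * q + 2).+1 * 2) (4 * q + 2).+1 (6 * q + 5)) => //.
- move=> x y; apply: pairE => //=; first by rewrite opprD addrACA.
  by rewrite opprD.
- by move=> x x2; apply: pairE; [apply: dn|apply: dm|apply: dm];
    move: (congr1 (fun z => z.1) x2) (congr1 (fun z => z.2.1) x2) (congr1 (fun z => z.2.2) x2).
- exact: ord_double0.
- move=> x x2; have := congr1 (fun z => z.1) x2; have := congr1 (fun z => z.2.1) x2.
  have /= := congr1 (fun z => z.2.2) x2 => h1 /eqP; rewrite oppr_eq0 => /eqP h2 /dn h3.
  exact: pairE.
- move=> x x2; have /= h3 := congr1 (fun z => z.1) x2; have /= h1 := congr1 (fun z => z.2.1) x2.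
  have /= h2 := congr1 (fun z => z.2.2) x2.
  have b0 : x.2.2 = 0 by apply: dm; rewrite -{1}h2 -h1 addNr.
  by apply: pairE; rewrite ?(fix0 _ h3) //= -h1 b0 oppr0.
- move=> x x2; have /= h3 := congr1 (fun z => z.1) x2; have /= h1 := congr1 (fun z => z.2.1) x2.
  have /= h2 := congr1 (fun z => z.2.2) x2.
  have b0 : x.2.2 = 0 by apply: dm; move/oppr_inj: h1 => {1}->; rewrite h2 addNr.
  by apply: pairE; rewrite ?(triple0 _ h3) //= h2 b0 oppr0.
- by apply: (hosted_triples_transport (f := f) _ _ (bose_design _)) => // ; lia.
- by rewrite cR; lia.
- have cRE := cR; rewrite card_prod card_ord in cRE; rewrite card_ord.
  case: eE => eE; last by rewrite (r_e eE) eqxx; move: cRE; rewrite eE; lia.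
  by move: (r.1 != 0) cRE => b; rewrite eE; case: b; lia.
- lia.
- by rewrite cR; lia.
- lia.
Qed.

Local Close Scope ring_scope.

Theorem theorem3p5 (t : nat) : 2 <= t ->
  exists (X : {set 'I_(14 * t + 6)}) (b : nat)
         (A : 'I_b -> {set 'I_(14 * t + 6)}) (phi : 'I_b -> 'I_(14 * t + 6)),
    weak_nesting X [set: 'I_(14 * t + 6)] (12 * t + 4) 3 2 (14 * t + 6) A phi.
Proof.
move=> t2; have tE := divn_eq t 3; set q := t %/ 3 in tE.
(* 4t + 1 is divisible by 3 only for the remainder 2; for the other two, 2 <= t gives 0 < q. *)
case r3: (t %% 3) (ltn_pmod t (isT : 0 < 3)) => [|[|[|//]]] _; rewrite r3 in tE.
- rewrite (_ : 12 * t + 4 = 36 * q + 4 + 12 * false); last by rewrite /=; lia.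
  by apply: weak_nesting_mod3_01; rewrite /=; lia.
- rewrite (_ : 12 * t + 4 = 36 * q + 4 + 12 * true); last by rewrite /=; lia.
  by apply: weak_nesting_mod3_01; rewrite /=; lia.
- rewrite (_ : 12 * t + 4 = 36 * q + 28); last by lia.
  by apply: weak_nesting_mod3_2; lia.
Qed.
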